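(* Consider a directed $a$-Based Network Augmentation instance: a directed graph $G=(V,E)$, a node $a\in V$, a set $F$ of edges on $V$ each leaving $a$, a set $D$ of ordered demand pairs with integer requirements $r_{uv}$, and for every $uv\in D$ a set function $f_{uv}:2^F\to\mathbb{Z}_+$ that is submodular and non-decreasing; the goal is a minimum-cost $I\subseteq F$ with $f_{uv}(I)\ge r_{uv}$ for all $uv\in D$. Then the problem admits a polynomial-time approximation algorithm with ratio $H(\alpha)$, where, in the case of nonnegative edge-costs on $F$ (cost of $I$ is $\sum_{e\in I}c_e$), $\alpha=\max_{e\in F}\sum_{uv\in D}[f_{uv}(\{e\})-f_{uv}(\emptyset)]$, and, in the case of nonnegative node-costs on $V$ (cost of $I$ is the cost of the set of endnodes of $I$), $\alpha=\max_{z\in V}\sum_{uv\in D}[f_{uv}(F_{\{z\}})-f_{uv}(\emptyset)]$.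
   Context: $H(j)=\sum_{i=1}^j 1/i$ is the $j$-th harmonic number. For $S\subseteq V$, $F_S$ denotes the set of edges of $F$ from $a$ to nodes of $S$. A set function $f$ on $F$ is submodular if $f(X)+f(Y)\ge f(X\cap Y)+f(X\cup Y)$ for all $X,Y\subseteq F$, and non-decreasing if $f(X)\le f(Y)$ whenever $X\subseteq Y$. The functions $f_{uv}$ are part of the input, given by polynomial-time evaluation oracles, and an approximation ratio $\rho$ means a polynomial-time algorithm returning a feasible solution of cost at most $\rho$ times the optimum (on feasible instances). *)

(* Defs.v *)
From HB Require Import structures.
From mathcomp Require Import all_boot all_order all_algebra.
Set Implicit Arguments. Unset Strict Implicit. Unset Printing Implicit Defensive.
Import Order.TTheory GRing.Theory Num.Theory.
Local Open Scope ring_scope.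

(** * Oracle random-access machines with logarithmic cost

  Algorithms are structured programs on an integer-addressed memory of
  integers.  Running time is the logarithmic cost of Aho, Hopcroft and Ullman:
  every integer that is touched, as an operand or as an address, is charged
  its bit length.  This is polynomially equivalent to Turing machine time. *)

(** [trunc_log 2 0 = 0], so both 0 and 1 have length 1. *)
Definition bitlen (z : int) : nat := (trunc_log 2 `|z|%N).+1.

Definition memory := int -> int.

Inductive expr : Type :=
| Cst of int
| Ref of expr
| Add of expr & expr
| Sub of expr & expr
| Mul of expr & expr
| Leq of expr & expr.

Inductive cmd : Type :=
| Skip
| Store of expr & expr                    (* Store addr val *)
| Query of expr & expr & expr & expr      (* Query addr u v x *)
| Seq of cmd & cmd
| If of expr & cmd & cmd
| While of expr & cmd.

Fixpoint eval (M : memory) (e : expr) : int :=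
  match e with
  | Cst z => z
  | Ref e1 => M (eval M e1)
  | Add e1 e2 => eval M e1 + eval M e2
  | Sub e1 e2 => eval M e1 - eval M e2
  | Mul e1 e2 => eval M e1 * eval M e2
  | Leq e1 e2 => (nat_of_bool (eval M e1 <= eval M e2))%:Z
  end.

Fixpoint ecost (M : memory) (e : expr) : nat :=
  match e with
  | Cst z => bitlen z
  | Ref e1 => (ecost M e1 + bitlen (eval M e1) + bitlen (M (eval M e1)))%N
  | Add e1 e2 | Sub e1 e2 | Mul e1 e2 | Leq e1 e2 =>
      (ecost M e1 + ecost M e2 + bitlen (eval M e1) + bitlen (eval M e2))%N
  end.

Definition upd (M : memory) (i z : int) : memory :=
  fun j => if j == i then z else M j.

Definition oracle := int -> int -> int -> int.

(** [exec O tau c M M' t]: started in memory [M], the program [c] halts in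
  memory [M'] at cost [t], where the evaluation oracle answers the query
  [(u, v, x)] with [O u v x] and takes time [tau u v x] to do so. *)
Inductive exec (O : oracle) (tau : int -> int -> int -> nat) :
    cmd -> memory -> memory -> nat -> Prop :=
| ExecSkip M : exec O tau Skip M M 1%N
| ExecStore M e1 e2 :
    exec O tau (Store e1 e2) M (upd M (eval M e1) (eval M e2))
      (1 + ecost M e1 + ecost M e2
         + bitlen (eval M e1) + bitlen (eval M e2))%N
| ExecQuery M e eu ev ex :
    exec O tau (Query e eu ev ex) M
      (upd M (eval M e) (O (eval M eu) (eval M ev) (eval M ex)))
      (1 + ecost M e + ecost M eu + ecost M ev + ecost M ex
         + bitlen (eval M e) + bitlen (eval M eu)
         + bitlen (eval M ev) + bitlen (eval M ex)
         + tau (eval M eu) (eval M ev) (eval M ex))%N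
| ExecSeq c1 c2 M M1 M2 t1 t2 :
    exec O tau c1 M M1 t1 -> exec O tau c2 M1 M2 t2 ->
    exec O tau (Seq c1 c2) M M2 (1 + t1 + t2)%N
| ExecIfTrue e c1 c2 M M' t :
    eval M e != 0 -> exec O tau c1 M M' t ->
    exec O tau (If e c1 c2) M M' (1 + ecost M e + t)%N
| ExecIfFalse e c1 c2 M M' t :
    eval M e == 0 -> exec O tau c2 M M' t ->
    exec O tau (If e c1 c2) M M' (1 + ecost M e + t)%N
| ExecWhileTrue e c M M1 M2 t1 t2 :
    eval M e != 0 -> exec O tau c M M1 t1 ->
    exec O tau (While e c) M1 M2 t2 ->
    exec O tau (While e c) M M2 (1 + ecost M e + t1 + t2)%N
| ExecWhileFalse e c M :
    eval M e == 0 -> exec O tau (While e c) M M (1 + ecost M e)%N.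

(** The input occupies the addresses 0, 1, 2, ...; all other cells hold 0. *)
Definition load (s : seq int) : memory :=
  fun i => if i is Posz k then nth 0 s k else 0.

(** Subsets of ['I_n] are communicated as bit masks: [i] belongs to the set iff
  bit [i] of [`|z|] is 1. *)
Definition mask_set (n : nat) (z : int) : {set 'I_n} :=
  [set i : 'I_n | odd (`|z|%N %/ 2 ^ i)%N].

(** * Approximation algorithms for minimization over subsets *)

Record problem : Type := Problem {
  inst : Type;
  encode : inst -> seq int;
  orc : inst -> oracle;
  ground : inst -> nat;
  feasible : forall N : inst, {set 'I_(ground N)} -> Prop;
  cost : forall N : inst, {set 'I_(ground N)} -> rat
}.

Definition inst_size (P : problem) (N : inst P) : nat :=
  (\sum_(z <- encode N) bitlen z)%N.

Definition optimal (P : problem) (N : inst P) (J : {set 'I_(ground N)}) : Prop :=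
  feasible J /\ forall K : {set 'I_(ground N)}, feasible K -> cost J <= cost K.

(** The oracle runs in time [q] in the size of the instance and of the query;
  as it has to write down its answer, its time bounds the answer's length. *)
Definition oracle_time (P : problem) (N : inst P) (q : {poly nat})
    (tau : int -> int -> int -> nat) : Prop :=
  forall u v x : int,
    (bitlen (orc N u v x) <= tau u v x)%N /\
    (tau u v x <= q.[inst_size N + bitlen u + bitlen v + bitlen x]%R)%N.

(** The program [A] does not depend on the polynomial [q] that bounds the time
  of the oracles, only its running time does.  It has to halt in polynomial
  time on every instance, feasible or not; it leaves its solution in cell 0. *)
Definition poly_approx (P : problem) (rho : inst P -> rat) : Prop :=
  exists A : cmd, forall q : {poly nat}, exists p : {poly nat},
  forall (N : inst P) (tau : int -> int -> int -> nat),
    oracle_time N q tau ->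
    exists (M : memory) (t : nat),
      [/\ exec (orc N) tau A (load (encode N)) M t,
          (t <= p.[inst_size N]%R)%N
        & (exists J : {set 'I_(ground N)}, feasible J) ->
          let I := mask_set (ground N) (M 0) in
          feasible I /\
          forall J : {set 'I_(ground N)},
            optimal J -> cost I <= rho N * cost J].

(** * Directed a-based network augmentation *)

Definition submodular (T : finType) (f : {set T} -> nat) : Prop :=
  forall X Y : {set T}, (f (X :&: Y) + f (X :|: Y) <= f X + f Y)%N.

Definition nondecreasing (T : finType) (f : {set T} -> nat) : Prop :=
  forall X Y : {set T}, X \subset Y -> (f X <= f Y)%N.

(** [V] is ['I_nV].  The edges of [F] are named by ['I_nF], so that parallel
  edges are allowed; [E] is a list for the same reason.  The values of [req]
  and [fval] outside [dem] are irrelevant. *)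
Record network : Type := Network {
  nV : nat;
  edges : seq ('I_nV * 'I_nV);
  root : 'I_nV;
  nF : nat;
  src : 'I_nF -> 'I_nV;
  tgt : 'I_nF -> 'I_nV;
  src_root : forall e : 'I_nF, src e = root;
  dem : {set 'I_nV * 'I_nV};
  req : 'I_nV * 'I_nV -> int;
  fval : 'I_nV * 'I_nV -> {set 'I_nF} -> nat;
  fval_submod : forall uv, uv \in dem -> submodular (fval uv);
  fval_mono : forall uv, uv \in dem -> nondecreasing (fval uv)
}.

Definition covers (N : network) (I : {set 'I_(nF N)}) : Prop :=
  forall uv : 'I_(nV N) * 'I_(nV N),
    uv \in dem N -> req uv <= (fval uv I)%:Z.

Definition f_oracle (N : network) : oracle :=
  fun u v x =>
    if [pick w in dem N | (u == (w.1 : nat)%:Z) && (v == (w.2 : nat)%:Z)]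
      is Some w then (fval w (mask_set (nF N) x))%:Z else 0.

Definition encode_pair (n : nat) (w : 'I_n * 'I_n) : seq int :=
  [:: (w.1 : nat)%:Z; (w.2 : nat)%:Z].

(** The nodes are listed one by one so that the size is at least [nV]. *)
Definition encode_network (N : network) : seq int :=
  [:: (nV N)%:Z; (root N : nat)%:Z;
      (size (edges N))%:Z; (nF N)%:Z; #|dem N|%:Z]
  ++ [seq (nat_of_ord v)%:Z | v <- enum 'I_(nV N)]
  ++ flatten [seq encode_pair w | w <- edges N]
  ++ flatten [seq encode_pair (src e, tgt e) | e <- enum 'I_(nF N)]
  ++ flatten [seq rcons (encode_pair w) (req w) | w <- enum (dem N)].

(** Costs are rational, so that they can be part of the input. *)
Definition encode_costs (n : nat) (c : 'I_n -> rat) : seq int :=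
  flatten [seq [:: numq (c i); denq (c i)] | i <- enum 'I_n].

Definition edges_to (N : network) (S : {set 'I_(nV N)}) : {set 'I_(nF N)} :=
  [set e | tgt e \in S].

Definition endnodes (N : network) (I : {set 'I_(nF N)}) : {set 'I_(nV N)} :=
  [set src e | e in I] :|: [set tgt e | e in I].

Record edge_inst : Type := EdgeInst {
  edge_net :> network;
  edge_cost : 'I_(nF edge_net) -> rat;
  edge_cost_ge0 : forall e, 0 <= edge_cost e
}.

Record node_inst : Type := NodeInst {
  node_net :> network;
  node_cost : 'I_(nV node_net) -> rat;
  node_cost_ge0 : forall v, 0 <= node_cost v
}.

Definition augmentation_edge : problem := {|
  inst := edge_inst;
  encode := fun N => encode_network N ++ encode_costs (@edge_cost N);
  orc := fun N => f_oracle N;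
  ground := fun N => nF N;
  feasible := fun N I => covers I;
  cost := fun N I => \sum_(e in I) edge_cost e
|}.

Definition augmentation_node : problem := {|
  inst := node_inst;
  encode := fun N => encode_network N ++ encode_costs (@node_cost N);
  orc := fun N => f_oracle N;
  ground := fun N => nF N;
  feasible := fun N I => covers I;
  cost := fun N I => \sum_(v in endnodes I) node_cost v
|}.

Definition harmonic (j : nat) : rat := \sum_(1 <= i < j.+1) (i%:R)^-1.

(** [fval uv] is nondecreasing, so the truncated subtractions are exact. *)
Definition alpha_edge (N : network) : nat :=
  (\max_(e : 'I_(nF N)) \sum_(uv in dem N) (fval uv [set e] - fval uv set0))%N.

Definition alpha_node (N : network) : nat :=
  (\max_(z : 'I_(nV N))
     \sum_(uv in dem N) (fval uv (edges_to [set z]) - fval uv set0))%N.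

(* Main.v *)
(** The algorithm is Wolsey's greedy algorithm for submodular covering.  The
  items are the edges, with [own] the identity, or the nodes, with [own] the
  target of an edge; picking an item adds the edges that it owns.  As every
  nonempty solution pays for the root, the root is made free in the second case.
  Let h be the sum over the demands of f truncated at the requirement, which is
  again submodular and nondecreasing, and solutions are the sets where h takes
  its maximal value.  If theta is the price per unit of gain of the last item
  picked, then along the greedy sequence S the quantity

    cost(S) + theta (h(K) - h(S))
      + \sum_(k in K) (c_k H(gain S k) - theta gain S k)

  does not increase, for every solution K, because H(a) - H(b) >= (a - b) / a.
  It starts at \sum_(k in K) c_k H(gain set0 k) and ends at cost(S).

  The running time of a program on memories whose cells have at most B bits is
  bounded by a syntactic function of the program, so the only semantic facts
  needed are bounds on the values stored and on the number of iterations. *)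

Require Import Defs.
From mathcomp Require Import all_boot all_order all_algebra.
From mathcomp Require Import zify ring lra.
(* [Sub] and [Seq] are shadowed by MathComp without this. *)
Import Defs.
Set Implicit Arguments. Unset Strict Implicit. Unset Printing Implicit Defensive.
Import Order.TTheory GRing.Theory Num.Theory.
Local Open Scope ring_scope.

(** * Weakest preconditions with bounded cells *)

Lemma bitlen_leP (z : int) (b : nat) :
  (0 < b)%N -> (bitlen z <= b)%N = (`|z| < 2 ^ b)%N.
Proof.
move=> b0; rewrite /bitlen; case: (posnP `|z|%N) => [->|z0].
  by rewrite trunc_log0 b0 expn_gt0.
apply/idP/idP => h.
  by apply: leq_trans (trunc_log_ltn _ (isT : 1 < 2)%N) _; rewrite leq_exp2l.
by rewrite -(@ltn_exp2l 2) //; apply: leq_ltn_trans (trunc_logP _ _) h.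
Qed.

Lemma bitlen_gt0 z : (0 < bitlen z)%N. Proof. by []. Qed.

Lemma bitlen_ub z : (`|z| < 2 ^ bitlen z)%N.
Proof. by rewrite -bitlen_leP. Qed.

(** Two numbers that are at least 2 have a sum no larger than their product, so adding integers
    costs no more bits than multiplying them. *)
Lemma ltn_add_exp (x y a b : nat) :
  (0 < a -> 0 < b -> x < 2 ^ a -> y < 2 ^ b -> x + y < 2 ^ (a + b))%N.
Proof.
move=> a0 b0 hx hy; rewrite expnD.
have ha : (2 <= 2 ^ a)%N by rewrite -{1}(expn1 2) leq_exp2l.
have hb : (2 <= 2 ^ b)%N by rewrite -{1}(expn1 2) leq_exp2l.
nia.
Qed.

Lemma bitlenD x y : (bitlen (x + y) <= bitlen x + bitlen y)%N.
Proof.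
rewrite bitlen_leP ?addn_gt0 //.
by apply: leq_ltn_trans (ltn_add_exp _ _ (bitlen_ub x) (bitlen_ub y)) => //; lia.
Qed.

Lemma bitlenN x : bitlen (- x) = bitlen x.
Proof. by rewrite /bitlen abszN. Qed.

Lemma bitlenB x y : (bitlen (x - y) <= bitlen x + bitlen y)%N.
Proof. by rewrite -(bitlenN y) bitlenD. Qed.

Lemma bitlenM x y : (bitlen (x * y) <= bitlen x + bitlen y)%N.
Proof.
rewrite bitlen_leP ?addn_gt0 // abszM expnD.
by apply: ltn_mul; apply: bitlen_ub.
Qed.

Lemma bitlen_nat (n : nat) : (bitlen n%:Z <= n.+1)%N.
Proof.
rewrite bitlen_leP //=; apply: leq_trans (ltn_expl n (isT : 1 < 2)%N) _.
by rewrite leq_exp2l.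
Qed.

Lemma bitlen_le_nat (n b : nat) : (n < b)%N -> (bitlen n%:Z <= b)%N.
Proof. exact: leq_trans (bitlen_nat n). Qed.

Lemma horner_nat_mono (p : {poly nat}) (m n : nat) :
  (m <= n)%N -> (p.[m] <= p.[n])%N.
Proof.
move=> le_mn; elim/poly_ind: p => [|p c IH]; first by rewrite !horner0.
by rewrite !hornerE /=; apply: leq_add => //; apply: leq_mul.
Qed.

(** * Functions bounded by a polynomial, and the running-time bound of a program *)

Definition polyb (h : nat -> nat) : Prop :=
  exists p : {poly nat}, forall n : nat, (h n <= p.[n])%N.

Lemma polyb_cst c : polyb (fun=> c).
Proof. by exists c%:P => n; rewrite hornerC. Qed.

Lemma polyb_id : polyb id.
Proof. by exists 'X => n; rewrite hornerX. Qed.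

Lemma polyb_add f g : polyb f -> polyb g -> polyb (fun n => f n + g n)%N.
Proof.
by move=> [p hp] [r hr]; exists (p + r) => n; rewrite hornerD leq_add.
Qed.

Lemma polyb_mul f g : polyb f -> polyb g -> polyb (fun n => f n * g n)%N.
Proof.
by move=> [p hp] [r hr]; exists (p * r) => n; rewrite hornerM leq_mul.
Qed.

Lemma polyb_succ : polyb succn.
Proof. by exists ('X + 1%:P) => n; rewrite hornerD hornerX hornerC /= -addn1. Qed.

Lemma polyb_horner (p : {poly nat}) f : polyb f -> polyb (fun n => p.[f n]).
Proof.
move=> [r hr]; exists (p \Po r) => n; rewrite horner_comp.
exact: horner_nat_mono.
Qed.

(* A bound, per bit of the memory cells, on the length of the value of an
   expression and on the cost of its evaluation. *)
Fixpoint esize (e : expr) : nat :=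
  match e with
  | Cst z => bitlen z
  | Ref e1 => (2 * esize e1).+1
  | Add e1 e2 | Sub e1 e2 | Mul e1 e2 | Leq e1 e2 =>
      (2 * (esize e1 + esize e2))%N
  end.

(** Here [s] stands for the instance size, [B] for the bit length of a cell and [q] for the oracle
    time. Every loop is charged [s.+1] rounds: at most [s] iterations and the final failing test. An
    [If] is charged both branches. *)
Fixpoint ctime (q : {poly nat}) (s B : nat) (c : cmd) : nat :=
  match c with
  | Skip => 1
  | Store e1 e2 => (1 + 2 * (esize e1 + esize e2) * B)%N
  | Query e eu ev ex =>
      (1 + 2 * (esize e + esize eu + esize ev + esize ex) * B
       + q.[s + (esize eu + esize ev + esize ex) * B]%R)%N
  | Seq c1 c2 => (1 + ctime q s B c1 + ctime q s B c2)%N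
  | If e c1 c2 => (1 + esize e * B + ctime q s B c1 + ctime q s B c2)%N
  | While e c1 => (s.+1 * (1 + esize e * B + ctime q s B c1))%N
  end.

Lemma polyb_ctime q (B : nat -> nat) c :
  polyb B -> polyb (fun s => ctime q s (B s) c).
Proof.
move=> hB; elim: c => [|e1 e2|e eu ev ex|c1 h1 c2 h2|e c1 h1 c2 h2|e c1 h1] /=;
  repeat first [exact: hB | exact: polyb_id | exact: polyb_succ | assumption
   | apply: polyb_horner | apply: (polyb_add (f := fun=> _)) | exact: polyb_cst
   | apply: polyb_add | apply: polyb_mul].
Qed.

Section WeakestPreconditions.

Variables (O : oracle) (tau : int -> int -> int -> nat).
Variables (q : {poly nat}) (s B : nat).
Hypothesis B_gt0 : (0 < B)%N.
Hypothesis tau_le : forall u v x,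
  (tau u v x <= q.[s + bitlen u + bitlen v + bitlen x]%R)%N.

Definition bounded (M : memory) : Prop := forall i, (bitlen (M i) <= B)%N.

(** An operation at most adds the lengths of its operands. The factor 2 in [esize] pays once for
    evaluating the operands and once for the charge on their values. *)
Lemma esizeP M e : bounded M ->
  (bitlen (eval M e) <= esize e * B)%N /\ (ecost M e <= esize e * B)%N.
Proof.
move=> bM; elim: e => [z|e1 [h1 h2]|e1 [h1 h2] e2 [h3 h4]|e1 [h1 h2] e2 [h3 h4]
  |e1 [h1 h2] e2 [h3 h4]|e1 [h1 h2] e2 [h3 h4]] /=.
- by split; apply: leq_pmulr.
- have h := bM (eval M e1); rewrite mulSn -mulnA.
  by split; [apply: leq_trans h (leq_addr _ _) | lia].
- by move: (bitlenD (eval M e1) (eval M e2)) => /leq_trans h;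
    rewrite -mulnA mulnDl; split; [apply: h|]; lia.
- by move: (bitlenB (eval M e1) (eval M e2)) => /leq_trans h;
    rewrite -mulnA mulnDl; split; [apply: h|]; lia.
- by move: (bitlenM (eval M e1) (eval M e2)) => /leq_trans h;
    rewrite -mulnA mulnDl; split; [apply: h|]; lia.
- have h := bitlen_gt0 (eval M e1); rewrite -mulnA mulnDl; split; last by lia.
  by case: (_ <= _)%R; rewrite (_ : bitlen _ = 1%N) //; lia.
Qed.

(** Total correctness that carries the time bound and the cell bound along, so that using the rules
    below leaves only the lengths of stored values and the iteration counts to check. *)
Definition wp (c : cmd) (Q : memory -> Prop) (M : memory) : Prop :=
  bounded M -> exists M' t,
  [/\ exec O tau c M M' t, (t <= ctime q s B c)%N, bounded M' & Q M'].

Lemma bounded_upd M i z : bounded M -> (bitlen z <= B)%N -> bounded (upd M i z).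
Proof. by move=> bM bz j; rewrite /upd; case: eqP. Qed.

Lemma wp_skip (Q : memory -> Prop) M : Q M -> wp Skip Q M.
Proof. by move=> QM bM; exists M, 1%N; split=> //; constructor. Qed.

Lemma wp_store e1 e2 (Q : memory -> Prop) M :
  (bitlen (eval M e2) <= B)%N -> Q (upd M (eval M e1) (eval M e2)) ->
  wp (Store e1 e2) Q M.
Proof.
move=> b2 QM bM; exists (upd M (eval M e1) (eval M e2)).
eexists; split; [exact: ExecStore| |exact: bounded_upd|exact: QM].
by have [? ?] := esizeP e1 bM; have [? ?] := esizeP e2 bM; rewrite /=; lia.
Qed.

Lemma wp_query e eu ev ex (Q : memory -> Prop) M :
  (bitlen (O (eval M eu) (eval M ev) (eval M ex)) <= B)%N ->
  Q (upd M (eval M e) (O (eval M eu) (eval M ev) (eval M ex))) ->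
  wp (Query e eu ev ex) Q M.
Proof.
move=> b2 QM bM; eexists; eexists.
split; [exact: ExecQuery| |exact: bounded_upd|exact: QM].
have [? ?] := esizeP e bM; have [? ?] := esizeP eu bM.
have [? ?] := esizeP ev bM; have [? ?] := esizeP ex bM => /=.
apply: leq_add; first by lia.
by apply: leq_trans (tau_le _ _ _) _; apply: horner_nat_mono; lia.
Qed.

Lemma wp_seq c1 c2 Q M : wp c1 (wp c2 Q) M -> wp (Defs.Seq c1 c2) Q M.
Proof.
move=> h bM; have [M1 [t1 [x1 l1 b1 h1]]] := h bM.
have [M2 [t2 [x2 l2 b2 h2]]] := h1 b1.
exists M2; eexists; split; [exact: ExecSeq x1 x2| |exact: b2|exact: h2].
by rewrite /= leq_add // leq_add2l.
Qed.

Lemma wp_if e c1 c2 Q M :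
  (eval M e != 0 -> wp c1 Q M) -> (eval M e == 0 -> wp c2 Q M) ->
  wp (If e c1 c2) Q M.
Proof.
move=> h1 h2 bM; have [_ ce] := esizeP e bM.
have [e0|e0] := boolP (eval M e == 0).
  have [M' [t [x l b h]]] := h2 e0 bM; exists M'; eexists.
  by split; [exact: ExecIfFalse e0 x| |exact: b|exact: h] => /=; lia.
have [M' [t [x l b h]]] := h1 e0 bM; exists M'; eexists.
by split; [exact: ExecIfTrue e0 x| |exact: b|exact: h] => /=; lia.
Qed.

(** The invariant is indexed by the number of completed iterations, and the loop runs exactly [n]
    times; [n <= s] is what [ctime] has paid for. *)
Lemma wp_while (I : nat -> memory -> Prop) n e c Q M :
  (n <= s)%N -> I 0%N M ->
  (forall k M', (k < n)%N -> I k M' -> eval M' e != 0 /\ wp c (I k.+1) M') ->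
  (forall M', I n M' -> eval M' e == 0 /\ Q M') ->
  wp (While e c) Q M.
Proof.
move=> le_ns I0 IS In bM.
(* Induction on the number [k] of iterations still to come, which need [k.+1] tests of the guard. *)
suff H k : (k <= n)%N -> forall M', bounded M' -> I (n - k)%N M' ->
    exists M'' t, [/\ exec O tau (While e c) M' M'' t,
      (t <= k.+1 * (1 + esize e * B + ctime q s B c))%N, bounded M'' & Q M''].
  have [|M' [t [x l b h]]] := H n (leqnn _) M bM; first by rewrite subnn.
  by exists M', t; split=> //=; apply: leq_trans l _;
    rewrite leq_mul2r ltnS le_ns orbT.
elim: k => [|k IHk] le_kn M1 b1 I1; have [_ ce] := esizeP e b1.
  move: I1; rewrite subn0 => /In [e0 QM].
  exists M1; eexists; split; [exact: ExecWhileFalse e0| |exact: b1|exact: QM].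
  by lia.
have lt_n : (n - k.+1 < n)%N by lia.
have [e0 /(_ b1) [M2 [t2 [x2 l2 b2]]]] := IS _ _ lt_n I1.
rewrite -subSn // subSS => I2.
have [M3 [t3 [x3 l3 b3 h3]]] := IHk (ltnW le_kn) M2 b2 I2.
exists M3; eexists; split; [exact: ExecWhileTrue e0 x2 x3| |exact: b3|exact: h3].
by rewrite [in leqRHS]mulSn; lia.
Qed.

Lemma wp_mono c (Q Q' : memory -> Prop) M :
  wp c Q M -> (forall M', Q M' -> Q' M') -> wp c Q' M.
Proof.
move=> h sQ bM; have [M' [t [x l b h']]] := h bM.
by exists M', t; split=> //; apply: sQ.
Qed.

End WeakestPreconditions.

(** * Greedy submodular covering *)

Lemma harmonicS j : harmonic j.+1 = harmonic j + j.+1%:R^-1.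
Proof. by rewrite /harmonic big_nat_recr. Qed.

Lemma harmonic0 : harmonic 0 = 0.
Proof. by rewrite /harmonic big_geq. Qed.

(** Each of the a - b reciprocals from 1/(b+1) to 1/a is at least 1/a. *)
Lemma harmonic_sub_ge (a b : nat) : (b <= a)%N ->
  (a - b)%:R / a%:R <= harmonic a - harmonic b.
Proof.
move=> le_ba; have [k ->] : exists k, a = (b + k)%N by exists (a - b)%N; lia.
rewrite addKn; elim: k => [|k IHk]; first by rewrite addn0 mul0r subrr.
rewrite addnS harmonicS -natr1 mulrDl mul1r addrAC lerD2r.
(* The larger denominator b+k+1 is traded for b+k. The case k = 0 is split off because b+k may then
   be 0, whose inverse is 0. *)
apply: le_trans IHk; case: k => [|k]; first by rewrite !mul0r.
by rewrite ler_pM2l ?ltr0n // lef_pV2 ?qualifE /= ?ltr0n ?addnS // ler_nat.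
Qed.

Lemma harmonic_mono (a b : nat) : (b <= a)%N -> harmonic b <= harmonic a.
Proof.
move=> le_ba; rewrite -subr_ge0; apply: le_trans (harmonic_sub_ge le_ba).
by rewrite divr_ge0.
Qed.

Lemma harmonic_ge1 a : (0 < a)%N -> 1 <= harmonic a.
Proof.
by move/harmonic_mono; apply: le_trans; rewrite harmonicS harmonic0 add0r invr1.
Qed.

Section Greedy.

Variables (T : finType) (h : {set T} -> nat) (c : T -> rat).
Hypothesis h_submod : submodular h.
Hypothesis h_mono : Defs.nondecreasing h.
Hypothesis c_ge0 : forall k, 0 <= c k.

Definition gain (S : {set T}) (k : T) : nat := (h (k |: S) - h S)%N.

Lemma gainE S k : (h (k |: S) = h S + gain S k)%N.
Proof. by rewrite subnKC // h_mono // subsetUr. Qed.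

Lemma gain_mem (S : {set T}) k : k \in S -> gain S k = 0%N.
Proof. by move=> kS; rewrite /gain (setUidPr _) ?sub1set ?subnn. Qed.

(** Diminishing returns: submodularity is applied to [k |: S] and [S'], whose intersection contains
    [S]. *)
Lemma gain_anti (S S' : {set T}) k : S \subset S' -> (gain S' k <= gain S k)%N.
Proof.
move=> sS; have := h_submod (k |: S) S'.
rewrite -setUA (setUidPr sS) !gainE setIUl (setIidPl sS) => hs.
suff : (h S <= h ([set k] :&: S' :|: S))%N by lia.
by apply: h_mono; apply: subsetUr.
Qed.

(** Add the elements of [K] one at a time; by diminishing returns each increment is at most the gain
    over [S]. *)
Lemma gain_sum (S K : {set T}) : (h (S :|: K) <= h S + \sum_(k in K) gain S k)%N.
Proof.
have [n] := ubnP #|K|; elim: n K => // n IHn K; rewrite ltnS => le_n.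
have [->|[k kK]] := set_0Vmem K; first by rewrite setU0 big_set0 addn0.
rewrite -(setD1K kK) in le_n *; move: le_n; set K' := K :\ k.
have {kK}kK : k \notin K' by rewrite !inE eqxx.
rewrite cardsU1 kK => /IHn IH; clearbody K'.
rewrite big_setU1 //= setUCA gainE.
have := @gain_anti S (S :|: K') k (subsetUl _ _); lia.
Qed.

(** The decreasing quantity of the proof without its summand cost(S). It is used for [K] of maximal
    [h], where the truncated subtraction is exact. *)
Definition potential (theta : rat) (S K : {set T}) : rat :=
  theta * (h K - h S)%N%:R
  + \sum_(k in K) (c k * harmonic (gain S k) - theta * (gain S k)%:R).

(** No item is sold below the price [theta] per unit of gain; hence greedy prices never fall. *)
Definition fair_price (theta : rat) (S : {set T}) : Prop :=
  0 <= theta /\ forall k, theta * (gain S k)%:R <= c k.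

(** The invariant of the greedy loop. Its first half serves the node costs: picking anything at all
    forces a positive [alpha]. *)
Definition greedy_bound (S : {set T}) : Prop :=
  {in S, forall k, (0 < gain set0 k)%N} /\
  exists theta, fair_price theta S /\ forall K, (forall S', (h S' <= h K)%N) ->
    \sum_(k in S) c k + potential theta S K <= potential 0 set0 K.

Lemma greedy_bound0 : greedy_bound set0.
Proof.
split=> [k|]; first by rewrite inE.
exists 0; split; first by split=> // k; rewrite mul0r.
by move=> K _; rewrite big_set0 add0r.
Qed.

(** The cost of [b] is exactly what the term th (h K - h S) loses. Raising the price from theta to
    th is paid for by [gain_sum]. What remains holds for each k in K: with gains x before and y
    after the step, c_k (H(x) - H(y)) >= c_k (x - y)/x >= th (x - y). *)
Lemma potential_step theta S K b :
  (forall S', (h S' <= h K)%N) -> fair_price theta S ->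
  (0 < gain S b)%N ->
  (forall k, c b * (gain S k)%:R <= c k * (gain S b)%:R) ->
  c b + potential (c b / (gain S b)%:R) (b |: S) K <= potential theta S K.
Proof.
move=> hK [th0 thP] gb0 bmin; set th := c b / (gain S b)%:R.
have gbR : 0 < (gain S b)%:R :> rat by rewrite ltr0n.
have th_ge : theta <= th by rewrite /th ler_pdivlMr.
have thS k : th * (gain S k)%:R <= c k.
  by rewrite /th mulrAC ler_pdivrMr.
have cb : c b = th * (gain S b)%:R by rewrite /th divfK ?gt_eqF.
rewrite {1}cb /potential gainE addrA -mulrDr -natrD.
have -> : (gain S b + (h K - (h S + gain S b)) = h K - h S)%N.
  by have := hK (b |: S); rewrite gainE; lia.
have sumR : (th - theta) * (h K - h S)%N%:R
    <= \sum_(k in K) (th - theta) * (gain S k)%:R.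
  rewrite -mulr_sumr ler_wpM2l ?subr_ge0 // -natr_sum ler_nat leq_subLR.
  by apply: leq_trans (gain_sum S K); apply: h_mono; apply: subsetUr.
suff H :
  \sum_(k in K) (c k * harmonic (gain (b |: S) k) - th * (gain (b |: S) k)%:R)
  + \sum_(k in K) (th - theta) * (gain S k)%:R
  <= \sum_(k in K) (c k * harmonic (gain S k) - theta * (gain S k)%:R) by lra.
rewrite -big_split /=; apply: ler_sum => k _.
have le_g := gain_anti k (subsetUr [set b] S).
have := harmonic_sub_ge le_g; rewrite natrB //.
set x := gain S k in le_g *; set y := gain _ k in le_g *.
case: (posnP x) => [x0|x0 hxy].
  by move: le_g; rewrite x0 leqn0 => /eqP -> _; rewrite !mulr0; lra.
have xR : 0 < x%:R :> rat by rewrite ltr0n.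
have := thS k; rewrite -/x => thx.
have yx : y%:R <= x%:R :> rat by rewrite ler_nat.
suff : th * (x%:R - y%:R) <= c k * (harmonic x - harmonic y) by lra.
apply: le_trans (ler_wpM2l (c_ge0 k) hxy).
by rewrite mulrA ler_pdivlMr // mulrAC ler_wpM2r ?subr_ge0.
Qed.

(** The new price is that of [b]. It stays fair because gains only shrink. The choice of [b] is
    stated with cross products, which also make sense for items without gain. *)
Lemma greedy_bound_step S b : greedy_bound S -> (0 < gain S b)%N ->
  (forall k, c b * (gain S k)%:R <= c k * (gain S b)%:R) ->
  greedy_bound (b |: S).
Proof.
move=> [pos [theta [fp hS]]] gb0 bmin; split=> [k|].
  rewrite !inE => /orP[/eqP->|/pos//].
  by apply: leq_trans gb0 _; apply: gain_anti; apply: sub0set.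
exists (c b / (gain S b)%:R); split.
  split; first by rewrite divr_ge0.
  move=> k; rewrite mulrAC ler_pdivrMr ?ltr0n //; apply: le_trans (bmin k).
  by rewrite ler_wpM2l // ler_nat gain_anti // subsetUr.
move=> K hK; rewrite big_setU1 /=; last first.
  by apply: contraTN gb0 => /gain_mem ->.
by have := hS K hK; have := potential_step hK fp gb0 bmin; lra.
Qed.

(** By [gain_sum] a local maximum of [h] is a global one. *)
Lemma no_gain S : (forall k, gain S k = 0%N) -> forall S', (h S' <= h S)%N.
Proof.
move=> g0 S'; apply: leq_trans (_ : h (S :|: S') <= _)%N.
  by apply: h_mono; apply: subsetUr.
by have := gain_sum S S'; rewrite big1 ?addn0.
Qed.

(** When no gain is left, the potential vanishes and the invariant reduces to this inequality. *)
Lemma greedy_cost S K : greedy_bound S -> (forall k, gain S k = 0%N) ->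
  (forall S', (h S' <= h K)%N) ->
  \sum_(k in S) c k <= \sum_(k in K) c k * harmonic (gain set0 k).
Proof.
move=> [_ [theta [_ hS]]] g0 hK; have := hS K hK.
have -> : potential theta S K = 0.
  rewrite /potential (_ : h K - h S = 0)%N; last first.
    by apply/eqP; rewrite subn_eq0 no_gain.
  by rewrite mulr0 add0r big1 // => k _; rewrite g0 harmonic0 !mulr0 subrr.
rewrite addr0 /potential mul0r add0r => /le_trans; apply.
by apply: ler_sum => k _; rewrite mul0r subr0.
Qed.

End Greedy.

(** * Bit masks and the encoding of instances *)

Definition set_mask (n : nat) (X : {set 'I_n}) : nat := (\sum_(i in X) 2 ^ i)%N.

Lemma set_maskE n (X : {set 'I_n}) :
  set_mask X = (\sum_(i < n) (i \in X) * 2 ^ i)%N.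
Proof.
rewrite /set_mask big_mkcond; apply: eq_bigr => i _.
by case: (i \in X); rewrite ?mul1n.
Qed.

Lemma sum_bitsS (b : nat -> bool) n :
  (\sum_(i < n.+1) b i * 2 ^ i = b 0 + 2 * \sum_(i < n) b i.+1 * 2 ^ i)%N.
Proof.
rewrite big_ord_recl muln1 big_distrr /=; congr addn.
by apply: eq_bigr => i _; rewrite /bump /= expnS; ring.
Qed.

Lemma odd_sum_bits (b : nat -> bool) n i : (i < n)%N ->
  odd ((\sum_(j < n) b j * 2 ^ j) %/ 2 ^ i) = b i.
Proof.
elim: n b i => // n IHn b i; rewrite sum_bitsS.
case: i => [_|i lt_in]; first by rewrite divn1 oddD oddM /= oddb addbF.
rewrite expnS divnMA -(IHn (fun i => b i.+1)) //; congr (odd (_ %/ _)).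
by rewrite mulnC addnC divnMDl // divn_small ?addn0 //; case: (b 0%N).
Qed.

Lemma set_maskK n (X : {set 'I_n}) : mask_set n (set_mask X)%:Z = X.
Proof.
apply/setP=> i; rewrite inE set_maskE /=.
(* [odd_sum_bits] shifts its bits and so indexes them by all naturals; membership in [X] is extended
   by [false]. *)
have := @odd_sum_bits (fun j => if insub j is Some j' then j' \in X else false) n i.
rewrite valK => <- //; congr (odd (_ %/ _)).
by apply: eq_bigr => j _; rewrite valK.
Qed.

Lemma set_mask_lt n (X : {set 'I_n}) : (set_mask X < 2 ^ n)%N.
Proof.
apply: (@leq_ltn_trans (\sum_(i < n) 2 ^ i)%N).
  by rewrite set_maskE; apply: leq_sum => i _; case: (i \in X); rewrite ?mul1n.
elim: n {X} => [|n IH]; first by rewrite big_ord0.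
by rewrite big_ord_recr /= expnS mul2n -addnn ltn_add2r.
Qed.

Lemma set_maskU n (X Y : {set 'I_n}) : [disjoint X & Y] ->
  set_mask (X :|: Y) = (set_mask X + set_mask Y)%N.
Proof.
by move=> dXY; rewrite /set_mask -bigU //=; apply: eq_bigl => i; rewrite !inE.
Qed.

Lemma bitlen_set_mask n (X : {set 'I_n}) : (bitlen (set_mask X)%:Z <= n.+1)%N.
Proof.
rewrite bitlen_leP // (leq_trans (set_mask_lt X)) // leq_exp2l //.
Qed.

Lemma size_flatten_map (T U : Type) (F : T -> seq U) c (s : seq T) :
  (forall x, size (F x) = c) -> size (flatten (map F s)) = (size s * c)%N.
Proof. by move=> Fc; elim: s => //= x s IH; rewrite size_cat Fc IH. Qed.

Lemma nth_flatten_map (T U : Type) (F : T -> seq U) c (s : seq T) x0 y0 i j :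
  (forall x, size (F x) = c) -> (i < size s)%N -> (j < c)%N ->
  nth y0 (flatten (map F s)) (i * c + j) = nth y0 (F (nth x0 s i)) j.
Proof.
move=> Fc; elim: s i => //= x s IH [|i] lt_i lt_j; rewrite nth_cat Fc.
  by rewrite mul0n add0n lt_j.
rewrite mulSn -addnA ltnNge leq_addr /= addKn.
exact: IH.
Qed.

Lemma nth_catD (T : Type) (x0 : T) (a b : seq T) n i :
  size a = n -> nth x0 (a ++ b) (n + i) = nth x0 b i.
Proof. by move=> <-; rewrite nth_cat ltnNge leq_addr addKn. Qed.

Lemma nth_catl (T : Type) (x0 : T) (a b : seq T) i :
  (i < size a)%N -> nth x0 (a ++ b) i = nth x0 a i.
Proof. by move=> lt_i; rewrite nth_cat lt_i. Qed.

Section Encoding.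

Variables (N : network) (C : seq int).

(** The demand triples come after five header cells, the list of nodes, and two cells for each edge
    of E and of F. *)
Definition demands_at := (5 + nV N + size (edges N) * 2 + nF N * 2)%N.
Definition costs_at := (demands_at + #|dem N| * 3)%N.

Let s := encode_network N ++ C.

Let net := [seq (nat_of_ord v)%:Z | v <- enum 'I_(nV N)]
  ++ flatten [seq encode_pair w | w <- edges N].
Let tgts := flatten [seq encode_pair (src e, tgt e) | e <- enum 'I_(nF N)].
Let dems := flatten [seq rcons (encode_pair w) (req w) | w <- enum (dem N)].

Let encodingE : s = [:: (nV N)%:Z; (root N : nat)%:Z;
      (size (edges N))%:Z; (nF N)%:Z; #|dem N|%:Z] ++ (net ++ tgts ++ dems ++ C).
Proof. by rewrite /s /encode_network /net -!catA. Qed.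

Let size_net : size net = (nV N + size (edges N) * 2)%N.
Proof.
by rewrite size_cat size_map -cardE card_ord (@size_flatten_map _ _ _ 2).
Qed.

Let size_tgts : size tgts = (nF N * 2)%N.
Proof. by rewrite (@size_flatten_map _ _ _ 2) // -cardE card_ord. Qed.

Let size_dems : size dems = (#|dem N| * 3)%N.
Proof. by rewrite (@size_flatten_map _ _ _ 3) // -cardE. Qed.

Lemma size_encoding : size s = (costs_at + size C)%N.
Proof.
move: size_net size_tgts size_dems; rewrite encodingE; move: net tgts dems => a b d.
by rewrite !size_cat /= => -> -> ->; rewrite /costs_at /demands_at !addnA.
Qed.

Lemma nth_encoding_net : [/\ nth 0 s 0 = nV N, nth 0 s 1 = (root N : nat),
  nth 0 s 2 = size (edges N), nth 0 s 3 = nF N & nth 0 s 4 = #|dem N|].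
Proof. by rewrite encodingE. Qed.

Lemma nth_encoding_tgt (e : 'I_(nF N)) :
  nth 0 s (5 + nV N + size (edges N) * 2 + e * 2 + 1) = (tgt e : nat).
Proof.
rewrite encodingE -!addnA nth_catD // addnA (nth_catD _ _ _ size_net).
rewrite nth_catl; last by rewrite size_tgts; have := ltn_ord e; lia.
rewrite (@nth_flatten_map _ _ _ 2 _ e) // ?size_enum_ord //.
by rewrite nth_ord_enum.
Qed.

Lemma nth_encoding_dem (w0 : 'I_(nV N) * 'I_(nV N)) d j :
  (d < #|dem N|)%N -> (j < 3)%N ->
  let w := nth w0 (enum (dem N)) d in
  nth 0 s (demands_at + d * 3 + j) = nth 0 (rcons (encode_pair w) (req w)) j.
Proof.
move=> lt_d lt_j w; rewrite encodingE /demands_at -!addnA nth_catD // addnA.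
rewrite (nth_catD _ _ _ size_net) (nth_catD _ _ _ size_tgts).
rewrite nth_catl; last by rewrite size_dems; lia.
by rewrite (@nth_flatten_map _ _ _ 3 _ w0) // -cardE.
Qed.

Lemma nth_encoding_cost i : nth 0 s (costs_at + i) = nth 0 C i.
Proof.
rewrite encodingE /costs_at /demands_at -!addnA nth_catD // addnA.
rewrite (nth_catD _ _ _ size_net) (nth_catD _ _ _ size_tgts).
by rewrite (nth_catD _ _ _ size_dems).
Qed.

End Encoding.

Lemma nth_encode_costs n (c : 'I_n -> rat) (k : 'I_n) :
  nth 0 (encode_costs c) (k * 2) = numq (c k)
  /\ nth 0 (encode_costs c) (k * 2 + 1) = denq (c k).
Proof.
rewrite -[(k * 2)%N]addn0 -addnA.
by split; rewrite (@nth_flatten_map _ _ _ 2 _ k) // ?size_enum_ord // nth_ord_enum.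
Qed.

(** The successor accounts for cells outside the input: they hold 0, which has length 1. *)
Lemma bitlen_load (t : seq int) i :
  (bitlen (load t i) <= (\sum_(z <- t) bitlen z).+1)%N.
Proof.
case: i => [k|k] //=; elim: t k => [|z t IH] [|k] //=; rewrite big_cons.
  by rewrite leqW ?leq_addr.
by apply: leq_trans (IH k) _; rewrite ltnS leq_addl.
Qed.

Lemma size_le_sum_bitlen (t : seq int) : (size t <= \sum_(z <- t) bitlen z)%N.
Proof. by rewrite -sum1_size leq_sum. Qed.

Lemma f_oracleE (N : network) w x : w \in dem N ->
  f_oracle N (w.1 : nat)%:Z (w.2 : nat)%:Z x = (fval w (mask_set (nF N) x))%:Z.
Proof.
move=> wD; rewrite /f_oracle; case: pickP => [w' /and3P[_]|/(_ w)].
  rewrite !eqz_nat => /eqP/val_inj e1 /eqP/val_inj e2.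
  by rewrite [w]surjective_pairing e1 e2 -surjective_pairing.
by rewrite wD !eqxx.
Qed.

(** * The greedy program *)

Local Notation num n := (Cst (Posz n)).
(** The input fills non-negative addresses, so the registers are at the negative ones, initially
    0. *)
Local Notation cell k := (Cst (Negz k)).
Local Notation var k := (Ref (Cst (Negz k))).
Local Notation input k := (Ref (Cst (Posz k))).
Local Notation "c1 ;; c2" := (Defs.Seq c1 c2) (at level 90, right associativity).

Local Notation loop i n c := (While (Leq (Add (var i) (num 1)) n)
  (c ;; Store (cell i) (Add (var i) (num 1)))).

(* Registers: 0 number of items, 1 address of the demands, 2 address of the
   costs, 3 mask of the current solution, 4 iterations done, 5 coverage of the
   current solution, 6 best gain, 7 best item, 8 current item, 9 mask to
   evaluate, 10 its coverage, 11 answer of the oracle, 12 current demand,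
   13 current power of 2, 14 current edge, 16 + k mask of the item k. *)

Definition demand_field (j : nat) : expr :=
  Add (Add (var 1) (Mul (var 12) (num 3))) (num j).

(** The maximum of 0 and the requirement, which may be negative. *)
Definition need_expr : expr :=
  Mul (Leq (num 0) (Ref (demand_field 2))) (Ref (demand_field 2)).

(** Each demand contributes the minimum of f and the need, written without branching as need +
    [f <= need] (f - need). *)
Definition coverage_prog : cmd :=
  Store (cell 10) (num 0) ;;
  Store (cell 12) (num 0) ;;
  loop 12 (input 4)
    (Query (cell 11) (Ref (demand_field 0)) (Ref (demand_field 1)) (var 9) ;;
     Store (cell 10) (Add (var 10)
       (Add need_expr (Mul (Leq (var 11) need_expr) (Sub (var 11) need_expr))))).

Definition item_cell (k : expr) : expr := Sub (cell 16) k.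

Definition cost_num (k : expr) : expr := Ref (Add (var 2) (Mul k (num 2))).
Definition cost_den (k : expr) : expr :=
  Ref (Add (Add (var 2) (Mul k (num 2))) (num 1)).

(* True for every item of positive gain as long as the best gain is 0. *)
Definition better_expr : expr :=
  Mul (Leq (num 1) (Sub (var 10) (var 5)))
    (Leq (Mul (Mul (cost_num (var 8)) (cost_den (var 7))) (var 6))
         (Mul (Mul (cost_num (var 7)) (cost_den (var 8)))
              (Sub (var 10) (var 5)))).

Definition scan_prog : cmd :=
  Store (cell 6) (num 0) ;;
  Store (cell 7) (num 0) ;;
  Store (cell 8) (num 0) ;;
  loop 8 (var 0)
    (Store (cell 9) (Add (var 3) (Ref (item_cell (var 8)))) ;;
     coverage_prog ;;
     If better_expr
       (Store (cell 6) (Sub (var 10) (var 5)) ;; Store (cell 7) (var 8)) Skip).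

(* The mask of a picked item becomes 0, so its later gains are 0. *)
Definition greedy_prog : cmd :=
  Store (cell 4) (num 0) ;;
  loop 4 (var 0)
    (Store (cell 9) (var 3) ;;
     coverage_prog ;;
     Store (cell 5) (var 10) ;;
     scan_prog ;;
     If (var 6)
       (Store (cell 3) (Add (var 3) (Ref (item_cell (var 7)))) ;;
        Store (item_cell (var 7)) (num 0)) Skip) ;;
  Store (num 0) (var 3).

(** The three parameters are all that distinguishes edge costs from node costs. Each edge in turn
    adds its power of 2 to the mask of the item given by [owner]. *)
Definition setup_prog (items owner : expr) (fix_costs : cmd) : cmd :=
  Store (cell 0) items ;;
  Store (cell 1) (Add (Add (Add (num 5) (input 0)) (Mul (input 2) (num 2)))
                      (Mul (input 3) (num 2))) ;;
  Store (cell 2) (Add (var 1) (Mul (input 4) (num 3))) ;;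
  fix_costs ;;
  Store (cell 13) (num 1) ;;
  loop 14 (input 3)
    (Store (item_cell owner) (Add (Ref (item_cell owner)) (var 13)) ;;
     Store (cell 13) (Add (var 13) (var 13))).

Definition augmentation_prog items owner fix_costs : cmd :=
  setup_prog items owner fix_costs ;; greedy_prog.

Lemma upd_eq M i z j : (j == i) = true -> upd M i z j = z.
Proof. by rewrite /upd => ->. Qed.

Lemma upd_ne M i z j : (j == i) = false -> upd M i z j = M j.
Proof. by rewrite /upd => ->. Qed.

Ltac upds := repeat match goal with |- context [upd ?M ?i ?z ?j] =>
  first [rewrite (@upd_eq M i z j erefl) | rewrite (@upd_ne M i z j erefl)] end.

Lemma loop_test (k n : nat) :
  (Posz (nat_of_bool (Posz k + Posz 1 <= Posz n)%R) != 0) = (k < n)%N.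
Proof. by rewrite -PoszD addn1 lez_nat; case: (k < n)%N. Qed.

Lemma succ_cell (k : nat) : Posz k + Posz 1 = k.+1.
Proof. by rewrite -PoszD addn1. Qed.

Definition need (r : int) : nat := if 0 <= r then `|r|%N else 0%N.

Lemma need_eval (r : int) : Posz (nat_of_bool (0 <= r)) * r = need r.
Proof. by rewrite /need; case: ifP => [r0|_]; rewrite ?mul0r // mul1r gez0_abs. Qed.

Lemma minn_eval (a b : nat) :
  Posz b + Posz (nat_of_bool (Posz a <= Posz b)) * (Posz a - Posz b) = minn a b.
Proof.
by rewrite lez_nat; case: leqP => h; rewrite ?mul0r ?addr0 // mul1r addrC subrK.
Qed.

(** * Truncated coverage of edge sets and of item sets *)

Section Coverage.

Variables (N : network) (m : nat) (own : 'I_(nF N) -> 'I_m).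

Definition coverage (X : {set 'I_(nF N)}) : nat :=
  (\sum_(w in dem N) minn (fval w X) (need (req w)))%N.

Lemma coverage_mono : Defs.nondecreasing coverage.
Proof.
move=> X Y sXY; apply: leq_sum => w wD.
by have := fval_mono wD sXY; lia.
Qed.

(** Truncation at a constant preserves submodularity of a nondecreasing function: once the values at
    the intersection and the union are ordered against those at X and Y, this is arithmetic of
    minima. *)
Lemma coverage_submod : submodular coverage.
Proof.
move=> X Y; rewrite /coverage -!big_split /=; apply: leq_sum => w wD.
have := fval_submod wD X Y.
have := fval_mono wD (subsetIl X Y); have := fval_mono wD (subsetIr X Y).
have := fval_mono wD (subsetUl X Y); have := fval_mono wD (subsetUr X Y).
lia.
Qed.

Definition item_coverage (S : {set 'I_m}) : nat := coverage (own @^-1: S).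

Lemma item_coverage_mono : Defs.nondecreasing item_coverage.
Proof. by move=> X Y sXY; apply: coverage_mono; apply: preimsetS. Qed.

Lemma item_coverage_submod : submodular item_coverage.
Proof.
by move=> X Y; rewrite /item_coverage preimsetI preimsetU; apply: coverage_submod.
Qed.

End Coverage.

(** * Correctness of the greedy program *)

Section Program.

Variables (N : network) (s B Qb : nat) (q : {poly nat}).
Variable tau : int -> int -> int -> nat.
Variables (m : nat) (own : 'I_(nF N) -> 'I_m) (c : 'I_m -> rat).
Variables (inp : nat -> int) (costs : nat) (cn cd : 'I_m -> int).

Hypothesis tau_le : forall u v x,
  (tau u v x <= q.[s + bitlen u + bitlen v + bitlen x]%R)%N.
Hypothesis answer_le : forall u v x, (bitlen (f_oracle N u v x) <= tau u v x)%N.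
Hypotheses (m_le : (m <= s)%N) (F_le : (nF N <= s)%N) (D_le : (#|dem N| <= s)%N).
Hypothesis V_le : (nV N <= s)%N.
(** [Qb] bounds the length of an answer: node names have at most [s] bits and masks at most [s.+1].
    A sum of at most [s] answers then has at most 1 + s Qb bits. *)
Hypothesis Qb_def : Qb = q.[s + s + s + s.+1]%R.
Hypotheses (B_s : (s + 2 <= B)%N) (B_Qb : (1 + s * Qb <= B)%N).
Hypothesis c_ge0 : forall k, 0 <= c k.
Hypothesis inp_dem_count : inp 4 = #|dem N|.
Hypothesis inp_dem : forall d j, (d < #|dem N|)%N -> (j < 3)%N ->
  let w := nth (root N, root N) (enum (dem N)) d in
  inp (demands_at N + d * 3 + j) = nth 0 (rcons (encode_pair w) (req w)) j.
Hypothesis inp_cn : forall k : 'I_m, inp (costs + k * 2) = cn k.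
Hypothesis inp_cd : forall k : 'I_m, inp (costs + k * 2 + 1) = cd k.
Hypothesis cd_gt0 : forall k, 0 < cd k.
Hypothesis cE : forall k, c k = (cn k)%:~R / (cd k)%:~R.

Let B_gt0 : (0 < B)%N. Proof. by apply: leq_trans B_s; rewrite addn2. Qed.

Local Notation wp := (wp (f_oracle N) tau q s B).
Local Notation seqw := wp_seq.
Local Notation store := (wp_store _ _ _ _ B_gt0).

Record static (M : memory) : Prop := Static {
  static_inp : forall i : nat, M (Posz i) = inp i;
  static_m : M (Negz 0) = m;
  static_dem : M (Negz 1) = demands_at N;
  static_costs : M (Negz 2) = costs
}.

(** A frame condition: [X] lists the cells that may have changed. *)
Definition agree (X : seq int) (M M' : memory) : Prop :=
  forall i, i \notin X -> M' i = M i.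

Lemma agree_upd X M M' i z : agree X M M' -> i \in X -> agree X M (upd M' i z).
Proof.
move=> a iX j jX; rewrite upd_ne; first exact: a.
by apply: contraNF jX => /eqP->.
Qed.

Lemma agree_trans X M M1 M2 : agree X M M1 -> agree X M1 M2 -> agree X M M2.
Proof. by move=> a b i iX; rewrite b // a. Qed.

Lemma agree_sub X Y M M' : {subset X <= Y} -> agree X M M' -> agree Y M M'.
Proof. by move=> sXY a i iY; apply: a; apply: contra iY; apply: sXY. Qed.

Lemma static_agree X M M' :
  all (fun i => if i is Negz k then (2 < k)%N else false) X ->
  agree X M M' -> static M -> static M'.
Proof.
move=> /allP hX a [h1 h2 h3 h4].
have aux i : (if i is Negz k then (2 < k)%N else false) = false -> M' i = M i.
  by move=> hi; apply: a; apply/negP => /hX; rewrite hi.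
by split=> [i|||]; rewrite aux.
Qed.

Definition partial_coverage d (X : {set 'I_(nF N)}) : nat :=
  (\sum_(w <- take d (enum (dem N))) minn (fval w X) (need (req w)))%N.

Lemma partial_coverageS d X : (d < #|dem N|)%N ->
  let w := nth (root N, root N) (enum (dem N)) d in
  partial_coverage d.+1 X
  = (partial_coverage d X + minn (fval w X) (need (req w)))%N.
Proof.
move=> lt_d w; rewrite /partial_coverage (take_nth (root N, root N)) -?cardE //.
by rewrite big_rcons /= addnC.
Qed.

Lemma partial_coverage_all X : partial_coverage #|dem N| X = coverage X.
Proof. by rewrite /partial_coverage cardE take_size big_enum. Qed.

Lemma bitlen_ord n (i : 'I_n) : (n <= s)%N -> (bitlen i <= s)%N.
Proof. by move=> h; apply: bitlen_le_nat; apply: leq_trans (ltn_ord i) h. Qed.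

(** Every value of f on a demand is the answer to the query with the mask of [X], hence no longer
    than the oracle's time. *)
Lemma bitlen_answer w X : w \in dem N -> (bitlen (fval w X) <= Qb)%N.
Proof.
move=> wD; rewrite -[X in fval w X]set_maskK -f_oracleE //.
apply: leq_trans (answer_le _ _ _) (leq_trans (tau_le _ _ _) _).
rewrite Qb_def; apply: horner_nat_mono.
have := bitlen_ord w.1 V_le; have := bitlen_ord w.2 V_le.
by have := bitlen_set_mask X; lia.
Qed.

Lemma bitlen_mono (a b : nat) : (a <= b)%N -> (bitlen a <= bitlen b)%N.
Proof. by move=> h; rewrite ltnS; apply: leq_trunc_log. Qed.

Lemma bitlen_partial_coverage d X : (d <= #|dem N|)%N ->
  (bitlen (partial_coverage d X) <= 1 + d * Qb)%N.
Proof.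
elim: d => [|d IHd] lt_d; first by rewrite /partial_coverage take0 big_nil.
rewrite partial_coverageS //; set w := nth _ _ _.
have wD : w \in dem N by rewrite -mem_enum mem_nth // -cardE.
rewrite PoszD mulSn addnCA [leqRHS]addnC.
apply: leq_trans (bitlenD _ _) (leq_add (IHd (ltnW lt_d)) _).
exact: leq_trans (bitlen_mono (geq_minl _ _)) (bitlen_answer _ wD).
Qed.

Lemma partial_coverage_B d X : (d <= #|dem N|)%N ->
  (bitlen (partial_coverage d X) <= B)%N.
Proof.
move=> le_d; apply: leq_trans (bitlen_partial_coverage X le_d) _.
apply: leq_trans B_Qb; rewrite leq_add2l leq_mul2r.
by rewrite (leq_trans le_d D_le) orbT.
Qed.

Lemma bitlen_coverage (X : {set 'I_(nF N)}) : (bitlen (coverage X) <= B)%N.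
Proof. by rewrite -partial_coverage_all partial_coverage_B. Qed.

Lemma bitlen_B (n : nat) : (n <= s)%N -> (bitlen n <= B)%N.
Proof. by move=> le_n; apply: bitlen_le_nat; lia. Qed.

Lemma Qb_B : (0 < #|dem N|)%N -> (Qb <= B)%N.
Proof. by move=> h; apply: leq_trans B_Qb; nia. Qed.

Definition scratch_coverage := [:: Negz 10; Negz 11; Negz 12].

Lemma wp_coverage (X : {set 'I_(nF N)}) (Q : memory -> Prop) M :
  static M -> M (Negz 9) = set_mask X ->
  (forall M', agree scratch_coverage M M' -> M' (Negz 10) = coverage X -> Q M') ->
  wp coverage_prog Q M.
Proof.
move=> st x9 HQ.
apply: seqw; apply: store => //=.
apply: seqw; apply: store => //=.
pose I (k : nat) (M' : memory) := [/\ agree scratch_coverage M M', M' (Negz 12) = k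
  & M' (Negz 10) = partial_coverage k X].
apply: (@wp_while _ _ _ _ _ B_gt0 I #|dem N|) => //.
- split; upds => //; first by do 2!apply: agree_upd => //.
  by rewrite /partial_coverage take0 big_nil.
- move=> k M1 lt_k [a1 k1 p1].
  have st1 : static M1 by apply: static_agree a1 st.
  have x1 : M1 (Negz 9) = set_mask X by rewrite a1.
  rewrite /= k1 (static_inp st1) inp_dem_count loop_test; split=> //.
  have iD j : (j < 3)%N -> inp (demands_at N + k * 3 + j) = _ := inp_dem lt_k.
  set w := nth _ _ _ in iD.
  have wD : w \in dem N by rewrite -mem_enum mem_nth // -cardE.
  have addr j : Posz (demands_at N) + Posz k * Posz 3 + Posz j
      = (demands_at N + k * 3 + j)%N by rewrite !PoszD PoszM.
  apply: seqw; apply: seqw; apply: (wp_query B_gt0 tau_le) => /=;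
    rewrite (static_dem st1) k1 x1 !addr !(static_inp st1) !iD //=
      f_oracleE // set_maskK.
    by apply: leq_trans (bitlen_answer _ wD) (Qb_B _); lia.
  apply: store => /=; upds;
    rewrite (static_dem st1) k1 p1 !addr; upds;
    rewrite (static_inp st1) iD //= need_eval minn_eval -PoszD
      -partial_coverageS //.
    exact: partial_coverage_B.
  apply: store => /=; upds; rewrite k1 succ_cell.
    by apply: bitlen_B; apply: leq_trans D_le.
  by split; upds => //; do 3!apply: agree_upd => //.
- move=> M1 [a1 k1 p1].
  have st1 : static M1 by apply: static_agree a1 st.
  split; last by apply: HQ => //; rewrite p1 partial_coverage_all.
  by rewrite /= k1 (static_inp st1) inp_dem_count -[_ == _]negbK loop_test ltnn.
Qed.

Local Notation h := (item_coverage own).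

Record state (S : {set 'I_m}) (M : memory) : Prop := State {
  state_static : static M;
  state_sol : M (Negz 3) = set_mask (own @^-1: S);
  state_items : forall k : 'I_m,
    M (Negz (16 + k)) = if k \in S then 0 else (set_mask (own @^-1: [set k]))%:Z
}.

Lemma state_agree X S M M' :
  all (fun i => if i is Negz k then (3 < k < 16)%N else false) X ->
  agree X M M' -> state S M -> state S M'.
Proof.
move=> hX a [st sol items].
have aux i : (if i is Negz k then (3 < k < 16)%N else false) = false -> M' i = M i.
  by move=> hi; apply: a; apply/negP => /(allP hX); rewrite hi.
split; first by apply: static_agree a st; apply: sub_all hX => -[] // k; lia.
- by rewrite aux.
- by move=> k; rewrite aux ?items.
Qed.

Lemma item_address (k : nat) : Negz 16 - Posz k = Negz (16 + k).
Proof. by rewrite !NegzE; lia. Qed.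

(** Adding masks gives the mask of the union only for disjoint sets: a picked item has mask 0, and
    any other owns no edge of the current solution. *)
Lemma add_item S M (k : 'I_m) : state S M ->
  M (Negz 3) + M (Negz (16 + k)) = set_mask (own @^-1: (k |: S)).
Proof.
move=> [_ -> ->]; case: ifP => kS; first by rewrite addr0 (setUidPr _) ?sub1set.
rewrite preimsetU set_maskU ?PoszD 1?addrC //.
rewrite -setI_eq0 -preimsetI; apply/eqP/setP => e; rewrite !inE.
by case: eqP => // ->; rewrite kS.
Qed.

(** The outcome of scanning the first [n] items. [D = 0] encodes that none had positive gain; [b] is
    then a placeholder. *)
Definition best_item (S : {set 'I_m}) (n : nat) (b : 'I_m) (D : nat) : Prop :=
  [/\ (0 < D)%N -> D = gain h S b,
      forall j : 'I_m, (j < n)%N -> c b * (gain h S j)%:R <= c j * D%:R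
    & D = 0%N -> forall j : 'I_m, (j < n)%N -> gain h S j = 0%N].

Lemma best_item_step S b D (k : 'I_m) : best_item S k b D ->
  let d := gain h S k in
  if (0 < d)%N && (c k * D%:R <= c b * d%:R) then best_item S k.+1 k d
  else best_item S k.+1 b D.
Proof.
move=> [hD hj hD0] d; have split_lt (j : 'I_m) : (j < k.+1)%N -> (j < k)%N \/ j = k.
  by rewrite ltnS leq_eqVlt => /orP[/eqP/val_inj|]; [right|left].
case: ifP => [/andP[d0 le_kb]|ltd].
  split=> // [j|e]; last by rewrite e in d0.
  move=> /split_lt[lt_jk|->//].
  case: (posnP D) => [D0|D_gt0]; first by rewrite hD0 // mulr0 mulr_ge0.
  have DR : 0 < D%:R :> rat by rewrite ltr0n.
  (* Transitivity of price comparisons c_k/d <= c_b/D <= c_j/gain_j, in cross products scaled by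
     D. *)
  rewrite -(ler_pM2r DR) mulrAC (le_trans (ler_wpM2r (ler0n _ _) le_kb)) //.
  by rewrite mulrAC [leRHS]mulrAC ler_wpM2r // hj.
split=> // [j|D0 j] /split_lt[lt_jk|->]; try by [apply: hj|apply: hD0].
  move: ltd; rewrite -/d; case: posnP => [-> _|_ /= /negbT].
    by rewrite mulr0 mulr_ge0.
  by rewrite -ltNge => /ltW.
apply/eqP; rewrite -leqn0 leqNgt; apply/negP => d0; move: ltd.
by rewrite -/d d0 D0 mulr0 /= mulr_ge0.
Qed.

Lemma better_eval (k b : 'I_m) (d D : nat) :
  (Posz (nat_of_bool (Posz 1 <= Posz d))
   * Posz (nat_of_bool (cn k * cd b * Posz D <= cn b * cd k * Posz d)) != 0)
  = (0 < d)%N && (c k * D%:R <= c b * d%:R).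
Proof.
have -> : (c k * D%:R <= c b * d%:R)
    = (cn k * cd b * Posz D <= cn b * cd k * Posz d).
  have pos j : 0 < (cd j)%:~R :> rat by rewrite ltr0z.
  rewrite !cE mulrAC ler_pdivrMr // -!mulrA [_^-1 * _]mulrC !mulrA ler_pdivlMr //.
  by rewrite ![_%:R]pmulrn -!intrM ler_int mulrAC [leRHS]mulrAC.
by rewrite lez_nat; case: (0 < d)%N; case: (_ <= _)%R.
Qed.

Definition scratch_scan :=
  [:: Negz 6; Negz 7; Negz 8; Negz 9; Negz 10; Negz 11; Negz 12].

Lemma wp_scan S (Q : memory -> Prop) M : (0 < m)%N ->
  state S M -> M (Negz 5) = h S ->
  (forall M' b D, agree scratch_scan M M' -> M' (Negz 6) = Posz D ->
     M' (Negz 7) = Posz (b : 'I_m) -> best_item S m b D -> Q M') ->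
  wp scan_prog Q M.
Proof.
move=> m_gt0 st hS HQ.
do 3!(apply: seqw; apply: store => //=).
pose I (k : nat) (M' : memory) := [/\ agree scratch_scan M M', M' (Negz 8) = k
  & exists (b : 'I_m) (D : nat),
    [/\ M' (Negz 6) = D, M' (Negz 7) = b & best_item S k b D]].
apply: (@wp_while _ _ _ _ _ B_gt0 I m) => //.
- split; upds => //; first by do 3!apply: agree_upd => //.
  (* Registers 6 and 7 start at 0: the placeholder is item 0, with no gain. *)
  by exists (Ordinal m_gt0), 0%N; split; upds.
- move=> k M1 lt_k [a1 k1 [b [D [D1 b1 best]]]].
  have st1 : state S M1 by apply: state_agree a1 st.
  rewrite /= k1 (static_m (state_static st1)) loop_test; split=> //.
  pose k' : 'I_m := Ordinal lt_k.
  apply: seqw.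
  (* The increment of the counter, shared by both branches of the conditional. *)
  have fin M3 : agree scratch_scan M1 M3 -> M3 (Negz 8) = k ->
      (exists (b : 'I_m) (D : nat),
        [/\ M3 (Negz 6) = D, M3 (Negz 7) = b & best_item S k.+1 b D]) ->
      wp (Store (cell 8) (Add (var 8) (num 1))) (I k.+1) M3.
    move=> a3 k3 best3; apply: store => /=; rewrite k3 succ_cell.
      by apply: bitlen_B; lia.
    by split; upds => //; apply: agree_upd => //; apply: agree_trans a1 a3.
  apply: seqw; apply: store => /=; rewrite k1 item_address (add_item k' st1).
    by apply: leq_trans (bitlen_set_mask _) _; lia.
  apply: seqw; apply: (wp_coverage (X := own @^-1: (k' |: S))).
  + by apply: (static_agree (X := scratch_scan)) (state_static st1) => //;
      apply: agree_upd.
  + by upds.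
  move=> M2 a2 cov.
  have a12 : agree scratch_scan M1 M2.
    apply: agree_trans (agree_sub _ a2); last by apply/allP.
    by apply: agree_upd.
  have M2M1 i : i \notin Negz 9 :: scratch_coverage -> M2 i = M1 i.
    by rewrite inE negb_or => /andP[i9 /a2->]; rewrite upd_ne // (negbTE i9).
  have [st2 k2 b2 D2 S2] : [/\ static M2, M2 (Negz 8) = k', M2 (Negz 7) = b,
      M2 (Negz 6) = D & M2 (Negz 5) = h S].
    rewrite !M2M1 // (a1 (Negz 5)) //; split=> //.
    exact: static_agree a12 (state_static st1).
  have dE : M2 (Negz 10) - M2 (Negz 5) = gain h S k'.
    by rewrite cov S2 /gain subzn // item_coverage_mono // subsetUr.
  have num_addr (j : 'I_m) : M2 (Posz costs + Posz j * Posz 2) = cn j.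
    by rewrite -PoszM -PoszD (static_inp st2) inp_cn.
  have den_addr (j : 'I_m) : M2 (Posz costs + Posz j * Posz 2 + Posz 1) = cd j.
    by rewrite -PoszM -!PoszD (static_inp st2) inp_cd.
  have test : (eval M2 better_expr != 0)
      = (0 < gain h S k')%N && (c k' * D%:R <= c b * (gain h S k')%:R).
    by rewrite -better_eval /= dE (static_costs st2) k2 b2 D2 !num_addr !den_addr.
  have step : if eval M2 better_expr != 0
      then best_item S k.+1 k' (gain h S k') else best_item S k.+1 b D.
    by rewrite test; apply: (@best_item_step S b D k').
  apply: (wp_if B_gt0) => t; rewrite t in step.
    apply: seqw; apply: store => /=; rewrite dE.
      by apply: leq_trans (bitlen_mono (leq_subr _ _)) (bitlen_coverage _).
    apply: store => /=; upds; rewrite k2.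
      by apply: bitlen_B; apply: leq_trans (ltnW lt_k) m_le.
    apply: fin; [by do 2!apply: agree_upd => //|by upds|].
    by exists k', (gain h S k'); split; upds.
  by apply: wp_skip; apply: fin => //; exists b, D.
- move=> M1 [a1 k1 [b [D [D1 b1 best]]]].
  have st1 : state S M1 by apply: state_agree a1 st.
  split; last by apply: HQ best.
  by rewrite /= k1 (static_m (state_static st1)) -[_ == _]negbK loop_test ltnn.
Qed.


Lemma state_add_item S M (b : 'I_m) : state S M ->
  state (b |: S)
    (upd (upd M (Negz 3) (set_mask (own @^-1: (b |: S)))) (Negz (16 + b)) 0).
Proof.
move=> st; have [st0 sol items] := st; split; last first.
- move=> k; rewrite !inE; have [->|ne_kb] := eqVneq k b.
    by rewrite upd_eq ?eqxx.
  rewrite upd_ne; last first.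
    by apply: contraNF ne_kb => /eqP[e]; apply/eqP/val_inj.
  by upds.
- by rewrite upd_ne //; upds.
apply: (static_agree (X := [:: Negz 3; Negz (16 + b)])) st0 => //.
by apply: agree_upd; [apply: agree_upd|]; rewrite // !inE eqxx ?orbT.
Qed.

Definition greedy_result (M : memory) : Prop := exists S : {set 'I_m},
  [/\ M (Posz 0) = set_mask (own @^-1: S), greedy_bound h c S
    & forall k, gain h S k = 0%N].

Lemma wp_greedy M : state set0 M -> wp greedy_prog greedy_result M.
Proof.
move=> st0; apply: seqw; apply: store => //=; apply: seqw.
(* The loop always makes [m] rounds, idling once nothing is gained. Either gains are exhausted or
   every round so far picked a new item, and after [m] such rounds [S] is everything. *)
pose I (it : nat) (M' : memory) := M' (Negz 4) = it /\ exists S : {set 'I_m},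
  [/\ state S M', greedy_bound h c S
    & (forall k, gain h S k = 0%N) \/ (it <= #|S|)%N].
apply: (@wp_while _ _ _ _ _ B_gt0 I m) => //.
- split; upds => //; exists set0; split; last by right.
    by apply: (state_agree (X := [:: Negz 4])) st0 => //; apply: agree_upd.
  exact: greedy_bound0.
- move=> it M1 lt_it [it1 [S [st1 gb prog]]].
  rewrite /= it1 (static_m (state_static st1)) loop_test; split=> //.
  apply: seqw.
  have fin (M2 : memory) S' : M2 (Negz 4) = it -> state S' M2 ->
      greedy_bound h c S' ->
      (forall k, gain h S' k = 0%N) \/ (it < #|S'|)%N ->
      wp (Store (cell 4) (Add (var 4) (num 1))) (I it.+1) M2.
    move=> it2 st2 gb2 prog2; apply: store => /=; rewrite it2 succ_cell.
      by apply: bitlen_B; apply: leq_trans m_le.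
    split; upds => //; exists S'; split=> //.
    by apply: (state_agree (X := [:: Negz 4])) st2 => //; apply: agree_upd.
  apply: seqw; apply: store => /=; rewrite (state_sol st1).
    by apply: leq_trans (bitlen_set_mask _) _; lia.
  apply: seqw; apply: (wp_coverage (X := own @^-1: S)); upds => //.
    by apply: (static_agree (X := [:: Negz 9])) (state_static st1) => //;
      apply: agree_upd.
  move=> M2 a2 cov2; have {a2}a2 : agree (Negz 9 :: scratch_coverage) M1 M2.
    apply: agree_trans (agree_sub _ a2); last by move=> i ii; rewrite inE ii orbT.
    by apply: agree_upd.
  apply: seqw; apply: store => /=; rewrite cov2; first exact: bitlen_coverage.
  set M3 := upd M2 _ _.
  have a3 : agree (Negz 5 :: Negz 9 :: scratch_coverage) M1 M3.
    by apply: agree_upd => //; apply: agree_sub a2 => i ii; rewrite inE ii orbT.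
  apply: seqw; apply: (wp_scan (S := S)); first by lia.
  + by apply: state_agree a3 st1.
  + by rewrite /M3; upds.
  move=> M4 b D a4 D4 b4 [hD hj hD0].
  have st4 : state S M4 by apply: state_agree a4 _ => //; apply: state_agree a3 st1.
  have it4 : M4 (Negz 4) = it by rewrite a4 // a3.
  apply: (wp_if B_gt0) => /=; rewrite D4 => t; last first.
    apply: wp_skip; apply: (fin _ S) => //; left=> k; apply: hD0 => //.
    exact/eqP.
  have D_gt0 : (0 < D)%N by case: (D) t.
  apply: seqw; apply: store => /=; rewrite b4 item_address (add_item _ st4).
    by apply: leq_trans (bitlen_set_mask _) _; lia.
  apply: store => //=; upds; rewrite b4 item_address.
  have gb0 : (0 < gain h S b)%N by rewrite -hD.
  apply: (fin _ (b |: S)); last 1 first.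
  + have bS : b \notin S by apply: contraTN gb0 => /gain_mem->.
    case: prog => [g0|le_it]; first by rewrite g0 in gb0.
    by right; rewrite cardsU1 bS add1n ltnS.
  + by rewrite upd_ne //; upds.
  + exact: state_add_item.
  + apply: greedy_bound_step => //.
    * exact: item_coverage_submod.
    * exact: item_coverage_mono.
    * by move=> k; rewrite -hD //; apply: hj.
- move=> M1 [it1 [S [st1 gb prog]]]; split.
    by rewrite /= it1 (static_m (state_static st1)) -[_ == _]negbK loop_test ltnn.
  apply: store => /=; rewrite (state_sol st1).
    by apply: leq_trans (bitlen_set_mask _) _; lia.
  exists S; upds; split=> // k; case: prog => // le_m; apply: gain_mem.
  have : S == setT by rewrite eqEcard subsetT cardsT card_ord.
  by move/eqP->; rewrite inE.
Qed.

Definition partial_item (k : 'I_m) (e : nat) : {set 'I_(nF N)} :=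
  [set i | (own i == k) && (i < e)%N].

Lemma partial_itemS k (e : 'I_(nF N)) :
  set_mask (partial_item k e.+1)
  = (set_mask (partial_item k e) + (own e == k) * 2 ^ e)%N.
Proof.
rewrite !set_maskE (bigD1 e) //= [in RHS](bigD1 e) //= !inE ltnn andbF mul0n add0n.
rewrite ltnSn andbT addnC; congr addn.
apply: eq_bigr => i ne_ie; rewrite !inE ltnS [(i <= e)%N]leq_eqVlt.
by rewrite (negbTE (_ : val i != val e)).
Qed.

(** * Setting up registers and item masks *)

Section Setup.

Variables (t : seq int) (items owner : expr) (fix_costs : cmd).
Hypothesis t_net : [/\ nth 0 t 0 = nV N, nth 0 t 1 = (root N : nat),
  nth 0 t 2 = size (edges N), nth 0 t 3 = nF N & nth 0 t 4 = #|dem N|].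
Hypothesis costs_le : (costs_at N <= s)%N.
Hypothesis costsE : costs = costs_at N.
Hypothesis inp_edge_count : inp 3 = nF N.
Hypothesis eval_items : forall M : memory,
  (forall i : nat, M (Posz i) = nth 0 t i) -> eval M items = m.
Hypothesis wp_fix_costs : forall (Q : memory -> Prop) (M : memory),
  (forall i : nat, M (Posz i) = nth 0 t i) -> M (Negz 2) = costs_at N ->
  (forall M', (forall i : nat, M' (Posz i) = inp i) ->
     (forall i, M' (Negz i) = M (Negz i)) -> Q M') -> wp fix_costs Q M.
Hypothesis eval_owner : forall (M : memory) (e : 'I_(nF N)),
  static M -> M (Negz 14) = e -> eval M owner = own e.

Lemma wp_setup : wp (setup_prog items owner fix_costs) (state set0) (load t).
Proof.
have [t0 t1 t2 t3 t4] := t_net.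
apply: seqw; apply: store; rewrite eval_items //; first exact: bitlen_B.
have demE : Posz 5 + Posz (nV N) + Posz (size (edges N)) * Posz 2
    + Posz (nF N) * Posz 2 = demands_at N by rewrite /demands_at !PoszD !PoszM.
apply: seqw; apply: store => /=; upds; rewrite /= t0 t2 t3 demE.
  by apply: bitlen_B; apply: leq_trans costs_le; apply: leq_addr.
have costsE' : Posz (demands_at N) + Posz #|dem N| * Posz 3 = costs_at N.
  by rewrite /costs_at PoszD PoszM.
apply: seqw; apply: store => /=; upds; rewrite /= t4 costsE'; first exact: bitlen_B.
apply: seqw; apply: wp_fix_costs => [i||M1 inp1 neg1]; upds => //.
apply: seqw; apply: store => //=.
pose I (e : nat) (M : memory) := [/\ static M, M (Negz 14) = e,
  M (Negz 13) = (2 ^ e)%N, M (Negz 3) = 0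
  & forall k : 'I_m, M (Negz (16 + k)) = set_mask (partial_item k e)].
apply: (@wp_while _ _ _ _ _ B_gt0 I (nF N)) => //.
- split; upds; rewrite ?neg1; upds => //; last first.
    move=> k; upds; rewrite neg1; upds; rewrite /= /set_mask big_pred0 //.
    by move=> i; rewrite inE ltn0 andbF.
  split=> [i|||]; upds; rewrite ?inp1 ?neg1 //; upds => //; by rewrite costsE.
- move=> e M2 lt_e [st2 e2 pow2 sol2 items2].
  rewrite /= e2 (static_inp st2) inp_edge_count loop_test; split=> //.
  pose e' : 'I_(nF N) := Ordinal lt_e.
  (* The power is doubled after the last edge too, so the exponent [nF N] itself must be allowed. *)
  have pow_B (i : nat) : (i <= nF N)%N -> (bitlen (2 ^ i)%N <= B)%N.
    move=> le_i; apply: (@leq_trans i.+1); last by lia.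
    by rewrite bitlen_leP //= ltn_exp2l.
  have itemE : set_mask (partial_item (own e') e.+1)
      = (set_mask (partial_item (own e') e) + 2 ^ e)%N.
    by rewrite (partial_itemS _ e') eqxx mul1n.
  apply: seqw; apply: seqw; apply: store => /=;
    rewrite (eval_owner (e := e')) // item_address items2 pow2 -PoszD -itemE.
    by apply: leq_trans (bitlen_set_mask _) _; lia.
  apply: store => /=; upds; rewrite pow2 -PoszD addnn -mul2n -expnS.
    exact: pow_B.
  apply: store => /=; upds; rewrite e2 succ_cell.
    by apply: bitlen_B; apply: leq_trans F_le.
  split; upds => //.
    apply: (static_agree (X := [:: Negz (16 + own e'); Negz 13; Negz 14])) st2 => //.
    apply: agree_upd; last by rewrite !inE eqxx !orbT.
    apply: agree_upd; last by rewrite !inE eqxx !orbT.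
    by apply: agree_upd; last by rewrite !inE eqxx.
  move=> k; upds; have [->|ne_k] := eqVneq k (own e').
    by rewrite upd_eq ?eqxx.
  rewrite upd_ne; last by apply: contraNF ne_k => /eqP[h]; apply/eqP/val_inj.
  by rewrite items2 (partial_itemS _ e') eq_sym (negbTE ne_k) mul0n addn0.
- move=> M2 [st2 e2 pow2 sol2 items2]; split.
    by rewrite /= e2 (static_inp st2) inp_edge_count -[_ == _]negbK loop_test ltnn.
  split=> //.
    by rewrite sol2 preimset0 /set_mask big_set0.
  move=> k; rewrite items2 inE; congr (Posz (set_mask _)).
  by apply/setP=> i; rewrite !inE ltn_ord andbT.
Qed.

Lemma run_augmentation : bounded B (load t) -> exists M time,
  [/\ exec (f_oracle N) tau (augmentation_prog items owner fix_costs)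
        (load t) M time,
      (time <= ctime q s B (augmentation_prog items owner fix_costs))%N
    & greedy_result M].
Proof.
move=> b0.
have : wp (augmentation_prog items owner fix_costs) greedy_result (load t).
  by apply: seqw; apply: wp_mono wp_setup wp_greedy.
by move=> /(_ b0)[M [time [h1 h2 _ h3]]]; exists M, time.
Qed.

End Setup.

End Program.

(** * Approximation ratio *)

Section GreedyResult.

Variables (N : network) (m : nat) (own : 'I_(nF N) -> 'I_m) (c : 'I_m -> rat).
Variable alpha : nat.
Hypothesis c_ge0 : forall k, 0 <= c k.
Hypothesis alpha_ge : forall k,
  (\sum_(uv in dem N) (fval uv (own @^-1: [set k]) - fval uv set0) <= alpha)%N.

Lemma need_le (r : int) (n : nat) : (r <= n%:Z) = (need r <= n)%N.
Proof. by rewrite /need; case: ifP; lia. Qed.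

Lemma coverage_le (X : {set 'I_(nF N)}) :
  (coverage X <= \sum_(w in dem N) need (req w))%N.
Proof. by apply: leq_sum => w _; apply: geq_minr. Qed.

(** Each summand is at most its need, so the sum reaches the total need exactly when every summand
    does. *)
Lemma covers_coverage (X : {set 'I_(nF N)}) :
  covers X <-> coverage X = (\sum_(w in dem N) need (req w))%N.
Proof.
split=> [cov|/eqP].
  by apply: eq_bigr => w wD; apply/minn_idPr; rewrite -need_le cov.
have /leqif_sum[_ ->] : forall w, w \in dem N ->
    leqif (minn (fval w X) (need (req w)))
    (need (req w)) (minn (fval w X) (need (req w)) == need (req w)).
  by move=> w _; apply/leqif_eq; apply: geq_minr.
move=> /forall_inP cov w wD.
by rewrite need_le; apply/minn_idPr/eqP; apply: cov.
Qed.

(** Truncation at the need can only shrink the increase of a nondecreasing function. *)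
Lemma gain0_le k : (gain (item_coverage own) set0 k <= alpha)%N.
Proof.
apply: leq_trans (alpha_ge k); rewrite /gain /item_coverage setU0 preimset0.
rewrite leq_subLR -big_split /=; apply: leq_sum => w wD.
have := fval_mono wD (sub0set (own @^-1: [set k])).
by move: (fval w _) (fval w _) (need _) => a b r; lia.
Qed.

(** The second clause is for the root: a nonempty choice means that some item gains over the empty
    set, so [alpha] is positive and the empty set infeasible. The last one replaces each initial
    gain in [greedy_cost] by [alpha]. *)
Lemma greedy_resultP M : greedy_result own c M -> exists S : {set 'I_m},
  [/\ mask_set (nF N) (M 0) = own @^-1: S,
      (0 < #|S|)%N -> (0 < alpha)%N /\ ~ covers (set0 : {set 'I_(nF N)})
    & forall K : {set 'I_m}, covers (own @^-1: K) -> covers (own @^-1: S)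
        /\ \sum_(k in S) c k <= harmonic alpha * \sum_(k in K) c k].
Proof.
move=> [S [MS gb g0]]; exists S; split; first by rewrite MS set_maskK.
  move=> /card_gt0P[k kS]; have gk := gb.1 k kS.
  split; first by apply: leq_trans gk (gain0_le k).
  move=> /covers_coverage cov0; move: gk.
  rewrite /gain subn_gt0 ltnNge /item_coverage preimset0 cov0.
  by rewrite coverage_le.
move=> K /covers_coverage covK.
have hK S' : (item_coverage own S' <= item_coverage own K)%N.
  by rewrite /item_coverage covK coverage_le.
have sub := item_coverage_submod own; have mon := item_coverage_mono own.
split.
  apply/covers_coverage/eqP; rewrite eqn_leq coverage_le -covK /=.
  exact: (no_gain sub mon g0 K).
apply: le_trans (greedy_cost sub mon gb g0 hK) _.
rewrite mulr_sumr; apply: ler_sum => k _; rewrite mulrC.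
by apply: ler_wpM2r => //; apply: harmonic_mono; apply: gain0_le.
Qed.

End GreedyResult.

(** The two lower bounds required of [B] are added rather than maximized, which keeps the expression
    polynomial. *)
Definition cell_bound (q : {poly nat}) (n : nat) : nat :=
  (n + 2 + (1 + n * q.[n + n + n + n.+1]%R))%N.

Lemma polyb_cell_bound q : polyb (cell_bound q).
Proof.
by do ?[exact: polyb_id | exact: polyb_succ | exact: polyb_cst
  | apply: polyb_horner | apply: polyb_add | apply: polyb_mul].
Qed.

(** * Running the program on an encoded instance *)

Section Run.

Variables (N : network) (m : nat) (own : 'I_(nF N) -> 'I_m) (cst : 'I_m -> rat).
Variables (free : pred 'I_m) (inp : nat -> int).
Variables (items owner : expr) (fix_costs : cmd).

Let t := encode_network N ++ encode_costs cst.
Let s := (\sum_(z <- t) bitlen z)%N.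

Hypothesis cst_ge0 : forall k, 0 <= cst k.
Hypothesis inp_low : forall i, (i < costs_at N)%N -> inp i = nth 0 t i.
Hypothesis inp_num : forall k : 'I_m,
  inp (costs_at N + k * 2) = if free k then 0 else numq (cst k).
Hypothesis inp_den : forall k : 'I_m, inp (costs_at N + k * 2 + 1) = denq (cst k).
Hypothesis eval_items : forall M : memory,
  (forall i : nat, M (Posz i) = nth 0 t i) -> eval M items = m.
Hypothesis eval_owner : forall (M : memory) (e : 'I_(nF N)),
  static N m inp (costs_at N) M -> M (Negz 14) = e -> eval M owner = own e.

Lemma run_greedy q tau :
  (forall u v x, (bitlen (f_oracle N u v x) <= tau u v x)%N
     /\ (tau u v x <= q.[s + bitlen u + bitlen v + bitlen x]%R)%N) ->
  (forall (Q : memory -> Prop) (M : memory),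
    (forall i : nat, M (Posz i) = nth 0 t i) -> M (Negz 2) = costs_at N ->
    (forall M', (forall i : nat, M' (Posz i) = inp i) ->
       (forall i, M' (Negz i) = M (Negz i)) -> Q M') ->
    wp (f_oracle N) tau q s (cell_bound q s) fix_costs Q M) ->
  exists M time,
  [/\ exec (f_oracle N) tau (augmentation_prog items owner fix_costs)
        (load t) M time,
      (time <= ctime q s (cell_bound q s)
                 (augmentation_prog items owner fix_costs))%N
    & greedy_result own (fun k => if free k then 0 else cst k) M].
Proof.
move=> tauP hfix.
have size_t : size t = (costs_at N + m * 2)%N.
  by rewrite size_encoding (@size_flatten_map _ _ _ 2) // size_enum_ord.
have : (costs_at N + m * 2 <= s)%N by rewrite -size_t size_le_sum_bitlen.
have lo : (5 + nV N + nF N * 2 + #|dem N| * 3 <= costs_at N)%N.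
  by rewrite /costs_at /demands_at leq_add2r leq_add2r leq_addr.
move=> size_s.
have nums := nth_encoding_net N (encode_costs cst).
have [_ _ _ t3 t4] := nums.
apply: (run_augmentation (inp := inp) (costs := costs_at N)
  (cn := fun k => if free k then 0 else numq (cst k)) (cd := fun k => denq (cst k))
  (Qb := q.[s + s + s + s.+1])) => //; rewrite /cell_bound;
  try by move: (q.[_])%R => *; lia.
all: try lia.
- by move=> u v x; case: (tauP u v x).
- by move=> u v x; case: (tauP u v x).
- by move=> k; case: (free k).
- by rewrite inp_low; [exact: t4|lia].
- move=> d j lt_d lt_j; rewrite inp_low; last first.
    by rewrite /costs_at; move: lt_d lt_j; move: #|_| (demands_at N) => *; lia.
  exact: (nth_encoding_dem _ (root N, root N)) lt_d lt_j.
- by move=> k; case: (free k); rewrite ?mul0r // divq_num_den.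
- by rewrite inp_low; [exact: t3|lia].
- by move=> i; apply: leq_trans (bitlen_load t i) _; rewrite -/s; lia.
Qed.

End Run.

Definition tgt_expr : expr :=
  Ref (Add (Add (Add (Add (num 5) (input 0)) (Mul (input 2) (num 2)))
                (Mul (var 14) (num 2))) (num 1)).

(** Only the numerator of the root's cost is erased; the denominator stays positive. *)
Definition drop_root_cost : cmd :=
  Store (Add (var 2) (Mul (input 1) (num 2))) (num 0).

Definition edge_prog : cmd := augmentation_prog (input 3) (var 14) Skip.

Definition node_prog : cmd := augmentation_prog (input 0) tgt_expr drop_root_cost.

Lemma edge_approx : poly_approx (P := augmentation_edge)
  (fun N : edge_inst => harmonic (alpha_edge N)).
Proof.
exists edge_prog => q; have [p hp] := polyb_ctime q edge_prog (polyb_cell_bound q).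
exists p => N tau tauP.
have [_ _ _ t3 _] := nth_encoding_net N (encode_costs (@edge_cost N)).
have [||k|k|||||M [time [ex_M le_time res]]] :=
  @run_greedy N (nF N) id (@edge_cost N) pred0
  (nth 0 (encode_network N ++ encode_costs (@edge_cost N)))
  (input 3) (var 14) Skip _ _ _ _ _ _ q tau.
- exact: edge_cost_ge0.
- by [].
- by rewrite nth_encoding_cost (nth_encode_costs _ k).1.
- by rewrite -addnA nth_encoding_cost (nth_encode_costs _ k).2.
- by move=> M /= ->.
- by move=> M e _ /= ->.
- exact: tauP.
- by move=> Q M inM _ HQ; apply: wp_skip; apply: HQ.
exists M, time; split=> //; first by apply: leq_trans le_time (hp _).
move=> [J0 J0_cov] I.
have [||S [IE _ SP]] := @greedy_resultP N _ id _ (alpha_edge N) _ _ M res.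
- by move=> k; apply: edge_cost_ge0.
- move=> k; rewrite /alpha_edge; apply: leq_trans (leq_bigmax k).
  by apply: leq_sum => w _; rewrite (_ : id @^-1: _ = [set k]) //;
    apply/setP=> e; rewrite !inE.
have preid (K : {set 'I_(nF N)}) : id @^-1: K = K by apply/setP=> e; rewrite !inE.
rewrite preid in IE; rewrite /I IE.
split; first by have := SP J0; rewrite !preid => /(_ J0_cov)[].
by move=> J [J_cov _]; have := SP J; rewrite !preid => /(_ J_cov)[].
Qed.

(** All edges leave the root, so a nonempty set pays for the root once, and the rest of its cost is
    that of its targets with the root made free. *)
Lemma endnodes_cost (N : network) (c : 'I_(nV N) -> rat) (I : {set 'I_(nF N)}) :
  \sum_(v in endnodes I) c v = (if I == set0 then 0 else c (root N))
    + \sum_(v in [set tgt e | e in I]) (if v == root N then 0 else c v).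
Proof.
rewrite /endnodes; case: eqVneq => [->|/set0Pn[e0 e0I]].
  by rewrite !imset0 setU0 !big_set0 addr0.
have -> : [set src e | e in I] = [set root N].
  apply/setP=> v; rewrite inE; apply/imsetP/eqP => [[e _ ->]|->].
    exact: src_root.
  by exists e0; rewrite ?src_root.
rewrite (bigD1 (root N)) /=; last by rewrite !inE eqxx.
congr (_ + _); rewrite [RHS]big_mkcond [LHS]big_mkcond /=; apply: eq_bigr => v _.
by rewrite !inE; case: (v == root N); rewrite ?andbF ?andbT ?if_same.
Qed.

Lemma node_approx : poly_approx (P := augmentation_node)
  (fun N : node_inst => harmonic (alpha_node N)).
Proof.
exists node_prog => q; have [p hp] := polyb_ctime q node_prog (polyb_cell_bound q).
exists p => N tau tauP.
set c := @node_cost N; set t := encode_network N ++ encode_costs c.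
have [t0 t1 t2 t3 t4] := nth_encoding_net N (encode_costs c).
pose inp i := if i == (costs_at N + root N * 2)%N then 0 else nth 0 t i.
have [|i lt_i|k|k|||||M [time [ex_M le_time res]]] :=
  @run_greedy N (nV N) (@tgt N) c
  (pred1 (root N)) inp (input 0) tgt_expr drop_root_cost _ _ _ _ _ _ q tau.
- exact: node_cost_ge0.
- by rewrite /inp ltn_eqF // (leq_trans lt_i) // leq_addr.
- rewrite /inp eqn_add2l eqn_pmul2r // nth_encoding_cost (nth_encode_costs _ k).1.
  by [].
- rewrite /inp -addnA eqn_add2l nth_encoding_cost (nth_encode_costs _ k).2.
  (* Denominators sit at odd offsets, so by parity none of them is the erased cell. *)
  by rewrite (_ : (_ == _)%N = false) //; apply/eqP; lia.
- by move=> M /= ->.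
- move=> M e [inM _ _ _] e14 /=; rewrite !inM e14.
  have low i : (i < costs_at N)%N -> inp i = nth 0 t i.
    by move=> lt_i; rewrite /inp ltn_eqF // (leq_trans lt_i) // leq_addr.
  have lt_e := ltn_ord e.
  rewrite !low ?t0 ?t2; try by rewrite /costs_at /demands_at -!addnA.
  have -> : Posz 5 + Posz (nV N) + Posz (size (edges N)) * Posz 2
      + Posz e * Posz 2 + Posz 1
    = (5 + nV N + size (edges N) * 2 + e * 2 + 1)%N by rewrite !PoszD !PoszM.
  rewrite inM low ?nth_encoding_tgt //.
  by rewrite /costs_at /demands_at; move: (#|_|) (size _) => *; lia.
- exact: tauP.
- move=> Q M inM M2 HQ; apply: wp_store => //=; try by rewrite /cell_bound addn2.
  rewrite M2 inM t1 -PoszM -PoszD; apply: HQ => [i|i]; last by rewrite upd_ne.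
  by rewrite /upd /inp eqz_nat; case: eqP.
exists M, time; split=> //; first by apply: leq_trans le_time (hp _).
move=> [J0 J0_cov] I.
set c' := fun k => _ in res.
have c'_ge0 k : 0 <= c' k
  by rewrite /c' /=; case: (_ == _) => //; apply: node_cost_ge0.
have [|S [IE S_gt0 SP]] :=
  @greedy_resultP N _ (@tgt N) _ (alpha_node N) c'_ge0 _ M res.
  by move=> k; rewrite /alpha_node; apply: leq_trans (leq_bigmax k).
rewrite -/I in IE.
(* The targets of [J], taken as items, own at least the edges of [J]. *)
have cov_tgt (J : {set 'I_(nF N)}) :
    covers J -> covers (@tgt N @^-1: [set tgt e | e in J]).
  move=> Jc uv uvD; apply: le_trans (Jc uv uvD) _; rewrite lez_nat.
  by apply: fval_mono => //; apply/subsetP => e eJ; rewrite inE imset_f.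
split; first by rewrite IE; have [] := SP _ (cov_tgt _ J0_cov).
move=> J [J_cov _]; have [_ le_S] := SP _ (cov_tgt _ J_cov).
rewrite /= !endnodes_cost -/c mulrDr.
have le_I : \sum_(v in [set tgt e | e in I]) c' v <= \sum_(k in S) c' k.
  rewrite [leRHS](big_setID [set tgt e | e in I]) /= (setIidPr _).
    by rewrite lerDl sumr_ge0.
  by apply/subsetP => _ /imsetP[e eI ->]; move: eI; rewrite IE inE.
apply: lerD; last by apply: le_trans le_I le_S.
have H0 : 0 <= harmonic (alpha_node N) by rewrite -harmonic0 harmonic_mono.
have croot : 0 <= c (root N) by apply: node_cost_ge0.
case: (eqVneq I set0) => [_|I0]; first by rewrite mulr_ge0 //; case: ifP.
(* If the output is nonempty, the empty set is infeasible, so [J] pays for the root as well, and the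
   harmonic factor is at least 1. *)
have [|alpha_gt0 ncov0] := S_gt0.
  rewrite card_gt0; apply: contraNneq I0 => S0.
  by rewrite IE S0 preimset0.
rewrite ifF; first by rewrite ler_peMl // harmonic_ge1.
by apply/eqP => J_0; apply: ncov0; rewrite -J_0.
Qed.

Theorem theorem2 :
  poly_approx (P := augmentation_edge)
    (fun N : edge_inst => harmonic (alpha_edge N))
  /\
  poly_approx (P := augmentation_node)
    (fun N : node_inst => harmonic (alpha_node N)).
Proof. by split; [apply: edge_approx | apply: node_approx]. Qed.
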